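(* Let $N,s,m$ be positive integers with $s\le N$, let $p\in[0,1]$, $\epsilon>0$ and $c>0$. There is a constant $C>0$ depending only on $c$ such that the following holds. Let $\mathbf{A}\in\mathbb{R}^{m\times N}$ be a subGaussian random matrix with parameter $c$, and let $\mathcal{T}\subseteq\{1,\ldots,m\}$ be the random set of indices of measurements observed at the fusion center of a star topology network, where each index $i$ belongs to $\mathcal{T}$ independently with probability $p$, independently of $\mathbf{A}$. Let $\delta\in(0,1)$. If $$m\ \ge\ \left[\ln\frac{1}{1-p+p\exp(-C\delta^2)}\right]^{-1}\left[\frac{4}{3}s\ln\left(\frac{eN}{s}\right)+\frac{14}{3}s+\frac{4}{3}\ln\frac{2}{\epsilon}\right],$$ then with probability at least $1-\epsilon$ the $s$-restricted isometry constant $\delta_s$ of $|\mathcal{T}|^{-1/2}\mathbf{A}_{\mathcal{T}}$ satisfies $\delta_s<\delta$.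
   Context: A random variable $A$ is subGaussian with parameter $c$ if $\mathbb{E}[\exp(\theta A)]\le\exp(c\theta^2)$ for all $\theta\in\mathbb{R}$. A random matrix is a subGaussian random matrix with parameter $c$ if its entries are independent, zero mean, unit variance subGaussian random variables with common parameter $c$. Star topology: each of the $m$ sensors sends its measurement (the $i$-th entry of $\mathbf{y}=\mathbf{A}\mathbf{x}+\mathbf{w}$) directly to the fusion center over an independent Bernoulli erasure channel which delivers the measurement with probability $p$ and loses it with probability $1-p$. $\mathbf{A}_{\mathcal{T}}$ denotes the $|\mathcal{T}|\times N$ submatrix of $\mathbf{A}$ formed by the rows indexed by $\mathcal{T}$ (a matrix with no rows if $\mathcal{T}=\emptyset$). For a matrix $\mathbf{B}$ with $N$ columns, its $s$-restricted isometry constant is $\delta_s=\inf\{\delta:1-\delta\le\|\mathbf{B}\mathbf{z}\|^2\le1+\delta\text{ for all }\mathbf{z}\in\mathbb{R}^N\text{ with }\|\mathbf{z}\|=1,\ \|\mathbf{z}\|_0\le s\}$, where $\|\cdot\|$ is the Euclidean norm and $\|\cdot\|_0$ the number of nonzero entries. The right-hand side is interpreted as $+\infty$ when $p=0$. *)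

(* Defs.v *)
From HB Require Import structures.
From mathcomp Require Import all_boot all_order all_algebra.
From mathcomp Require Import all_classical all_reals all_analysis.
Set Implicit Arguments. Unset Strict Implicit. Unset Printing Implicit Defensive.
Import Order.TTheory GRing.Theory Num.Theory.
Local Open Scope classical_set_scope.
Local Open Scope ring_scope.

(* Mutual independence of a finite family of real random variables:
   product rule for every choice of Borel sets (taking B k = setT for the
   indices not involved recovers the rule for any sub-family). *)
Definition mutually_independent {d} {Omega : measurableType d} {R : realType}
  (P : probability Omega R) (I : finType) (X : I -> Omega -> R) : Prop :=
  forall B : I -> set R, (forall k, measurable (B k)) ->
    P [set w | forall k, B k (X k w)] = (\prod_(k : I) P (X k @^-1` B k))%E.

Definition subGaussian {d} {Omega : measurableType d} {R : realType}
  (P : probability Omega R) (c : R) (X : Omega -> R) : Prop :=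
  forall theta : R, (\int[P]_w (expR (theta * X w))%:E <= (expR (c * theta ^+ 2))%:E)%E.

Definition subGaussian_entry {d} {Omega : measurableType d} {R : realType}
  (P : probability Omega R) (c : R) (X : Omega -> R) : Prop :=
  [/\ measurable_fun setT X,
      P.-integrable setT (fun w => (X w)%:E),
      (\int[P]_w (X w)%:E = 0)%E,
      (\int[P]_w ((X w) ^+ 2)%:E = 1)%E &
      subGaussian P c X].

Definition sqnorm {R : realType} {k : nat} (v : 'cV[R]_k) : R :=
  \sum_(i < k) v i 0 ^+ 2.

Definition l0 {R : realType} {N : nat} (z : 'cV[R]_N) : nat :=
  #|[set j : 'I_N | z j 0 != 0]|.

Definition ric {R : realType} {k N : nat} (s : nat) (B : 'M[R]_(k, N)) : R :=
  inf [set dl : R | forall z : 'cV[R]_N, sqnorm z = 1 -> (l0 z <= s)%N ->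
         1 - dl <= sqnorm (B *m z) /\ sqnorm (B *m z) <= 1 + dl].

Definition rows_of {R : realType} {m N : nat} (T : {set 'I_m}) (A : 'M[R]_(m, N))
  : 'M[R]_(#|T|, N) :=
  rowsub (fun k : 'I_#|T| => enum_val k) A.

Definition normalized_sub {R : realType} {m N : nat} (T : {set 'I_m}) (A : 'M[R]_(m, N))
  : 'M[R]_(#|T|, N) :=
  (Num.sqrt (#|T|%:R))^-1 *: rows_of T A.

(* Main.v *)
Require Import Defs.
From HB Require Import structures.
From mathcomp Require Import all_boot all_order all_algebra.
From mathcomp Require Import all_classical all_reals all_analysis.
From mathcomp Require Import measurable_realfun ring lra.
Import Order.TTheory GRing.Theory Num.Theory.
Import numFieldNormedType.Exports.
Set Implicit Arguments. Unset Strict Implicit. Unset Printing Implicit Defensive.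
Local Open Scope classical_set_scope.
Local Open Scope ring_scope.

(** For a fixed vector [y] of norm at most 1, the squares of the measurements [(A y)_i] have
    mean [|y|^2] and, being squares of subGaussian variables, satisfy
    [E exp (l ((A y)_i^2 - |y|^2)) <= exp (K l^2)] for small [l].  Multiplying the exponent by
    the indicator of [i \in T] before taking expectations turns each factor into
    [1 - p + p exp (K l^2 - tau)], so a Chernoff bound holds for the random row set without
    conditioning on [T].  A union bound over a lattice net of the sparse unit vectors, whose
    cardinality is controlled by a generating function, then bounds the probability that
    [|B y|^2 - |y|^2] exceeds [delta / 4] somewhere on the net; outside this event a polarization
    argument gives [delta_s <= delta / 2].  Since [P] is only meaningful on measurable sets, the
    event [delta_s < delta] is also shown to be measurable, by restricting to rational vectors. *)

(** * Independence of disjoint blocks of variables *)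

Section block_independence.
Context {d} {Omega : measurableType d} {R : realType} (P : probability Omega R).
Context {I : finType} (X : I -> Omega -> R).
Hypothesis mX : forall k, measurable_fun setT (X k).
Hypothesis indX : mutually_independent P X.

(** A pi-system generating the sigma-algebra of the [X k] with [k] in [J]. The sets [B k] are given
    for every index so that the families of two blocks can be merged into one. *)
Definition cylinders (J : pred I) : set (set Omega) :=
  [set E | exists2 B : I -> set R, (forall k, measurable (B k)) &
     E = [set w | forall k, J k -> B k (X k w)]].

Lemma cylinders_setI_closed J : setI_closed (cylinders J).
Proof.
move=> _ _ [A mA ->] [B mB ->]; exists (fun k => A k `&` B k).
  by move=> k; exact: measurableI.
apply/seteqP; split=> w /=.
  by move=> [HA HB] k Jk; split; [exact: HA|exact: HB].
by move=> H; split=> k /H [].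
Qed.

Lemma cylinders_setT J : cylinders J setT.
Proof. by exists (fun=> setT) => //; apply/seteqP; split. Qed.

Lemma cylinders_measurable J : cylinders J `<=` measurable.
Proof.
move=> _ [B mB ->].
rewrite (_ : [set _ | _] = \bigcap_(k in [set k | J k]) (X k @^-1` B k)); last first.
  by apply/seteqP; split.
apply: fin_bigcap_measurable; first exact: finite_finset.
by move=> k _; rewrite -[_ @^-1` _]setTI; exact: mX.
Qed.

Lemma preimage_in_cylinders (J : pred I) k (B : set R) :
  J k -> measurable B -> cylinders J (X k @^-1` B).
Proof.
move=> Jk mB; exists (fun l => if l == k then B else setT).
  by move=> l; case: ifP.
apply/seteqP; split=> w /=.
  by move=> HB l _; case: eqP => // ->.
by move=> /(_ k Jk); rewrite eqxx.
Qed.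

Lemma block_measurable_fun (J : pred I) k : J k ->
  measurable_fun setT (X k : g_sigma_algebraType (cylinders J) -> R).
Proof.
move=> Jk _ B mB; rewrite setTI; apply: sub_sigma_algebra.
exact: preimage_in_cylinders.
Qed.

Lemma block_sigma_measurable J E : <<s cylinders J >> E -> measurable E.
Proof.
by apply: smallest_sub; [exact: sigma_algebra_measurable|exact: cylinders_measurable].
Qed.

Lemma block_measurable_fun_measurable J (U : Omega -> R) :
  measurable_fun setT (U : g_sigma_algebraType (cylinders J) -> R) ->
  measurable_fun setT U.
Proof.
move=> mU _ B mB; apply: (@block_sigma_measurable J).
exact: (mU measurableT B mB).
Qed.

Lemma cylinders_prob (J : pred I) (B : I -> set R) : (forall k, measurable (B k)) ->
  P [set w | forall k, J k -> B k (X k w)] = (\prod_(k | J k) P (X k @^-1` B k))%E.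
Proof.
move=> mB; pose B' k := if J k then B k else setT.
have mB' k : measurable (B' k) by rewrite /B'; case: ifP.
rewrite (_ : [set _ | _] = [set w | forall k, B' k (X k w)]); last first.
  apply/seteqP; split=> w /= H k; rewrite /B'.
    by case: ifP => // /H.
  by move=> Jk; move: (H k); rewrite /B' Jk.
rewrite indX // [RHS]big_mkcond; apply: eq_bigr => k _; rewrite /B'.
by case: ifP => // _; rewrite preimage_setT probability_setT.
Qed.

Lemma cylinders_indep J E F : cylinders J E -> cylinders (predC J) F ->
  P (E `&` F) = (P E * P F)%E.
Proof.
move=> [A mA ->] [B mB ->]; pose C k := if J k then A k else B k.
have mC k : measurable (C k) by rewrite /C; case: ifP.
rewrite (_ : _ `&` _ = [set w | forall k, C k (X k w)]); last first.
  apply/seteqP; split=> w /=.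
    by move=> [HA HB] k; rewrite /C; case: ifPn; [exact: HA|exact: HB].
  move=> H; split=> k Jk; move: (H k); rewrite /C; first by rewrite Jk.
  by rewrite (negbTE Jk).
rewrite indX// !cylinders_prob// (bigID J)/=; congr (_ * _)%E.
  by apply: eq_bigr => k Jk; rewrite /C Jk.
by apply: eq_bigr => k Jk; rewrite /C (negbTE Jk).
Qed.

(** Restricting [P] to [F] and scaling [P] by the number [P F] give two finite measures that agree
    on a pi-system containing the whole space, hence on the sigma-algebra it generates. *)
Lemma independent_of_pi_system (G : set (set Omega)) F :
  G `<=` measurable -> setI_closed G -> G setT -> measurable F ->
  (forall E, G E -> P (E `&` F) = (P E * P F)%E) ->
  forall E, <<s G >> E -> P (E `&` F) = (P E * P F)%E.
Proof.
move=> mG GI GT mF GF E sE.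
have PF0 : 0 <= fine (P F) by exact: fine_ge0.
have PFE : P F = (fine (P F))%:E by rewrite fineK// fin_num_measure.
transitivity (mscale (NngNum PF0) P E); last by rewrite /mscale/= muleC [in RHS]PFE.
apply: (@g_sigma_algebra_measure_unique _ _ _ G mG (fun=> setT) _ _
  (mrestr P mF) (mscale (NngNum PF0) P)) => //.
- exact: bigcup_const.
- move=> A GA; transitivity (P A * P F)%E; first exact: GF.
  by rewrite /mscale/= muleC [in LHS]PFE.
- by move=> _; change (P (setT `&` F) < +oo)%E; rewrite setTI PFE ltry.
Qed.

(** The pi-system argument runs twice, passing from cylinders to the sigma-algebra in one factor at
    a time. *)
Lemma block_indep J E F : <<s cylinders J >> E -> <<s cylinders (predC J) >> F ->
  P (E `&` F) = (P E * P F)%E.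
Proof.
move=> sE sF; have mF := block_sigma_measurable sF.
apply: (@independent_of_pi_system (cylinders J)) => //.
- exact: cylinders_measurable.
- exact: cylinders_setI_closed.
- exact: cylinders_setT.
move=> E' sE'; rewrite setIC muleC.
apply: (@independent_of_pi_system (cylinders (predC J))) => //.
- exact: cylinders_measurable.
- exact: cylinders_setI_closed.
- exact: cylinders_setT.
- exact: cylinders_measurable sE'.
by move=> F' sF'; rewrite setIC muleC; exact: (cylinders_indep sE' sF').
Qed.

End block_independence.

(** * Expectation of a product of independent variables *)

Section product_expectation.
Context {d} {Omega : measurableType d} {R : realType} (P : probability Omega R).
Context (U V : Omega -> R).
Hypotheses (mU : measurable_fun setT U) (mV : measurable_fun setT V).
Hypothesis indUV : forall A B : set R, measurable A -> measurable B ->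
  P (U @^-1` A `&` V @^-1` B) = (P (U @^-1` A) * P (V @^-1` B))%E.

Let mUV : measurable_fun setT (fun w => (U w, V w)).
Proof. exact: measurable_fun_pair. Qed.

Let PU := distribution P (mfun_Sub (mem_set mU)).
Let PV := distribution P (mfun_Sub (mem_set mV)).
Let PUV := distribution P (mfun_Sub (mem_set mUV)).

Let joint_law (A : set (R * R)) : measurable A -> (PU \x PV)%E A = PUV A.
Proof.
by move=> mA; apply: product_measure_unique => // B C mB mC; exact: indUV.
Qed.

Local Open Scope ereal_scope.

(** Independence makes the joint law a product measure, so Tonelli applies without integrability.
    The result serves both for the integrability of products and for products of nonnegative
    variables. *)
Lemma expectation_prod_abs :
  \int[P]_w (`|U w * V w|%R)%:E = (\int[P]_w (`|U w|%R)%:E) * (\int[P]_w (`|V w|%R)%:E).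
Proof.
pose f (z : R * R) : \bar R := (`|z.1 * z.2|%R)%:E.
have mf : measurable_fun setT f.
  by apply/measurable_EFinP; apply: measurableT_comp => //; exact: measurable_funM.
have f0 z : 0 <= f z by rewrite /f lee_fin.
have mabs : measurable_fun setT (fun x : R => (`|x|%R)%:E).
  by apply/measurable_EFinP; exact: normr_measurable.
transitivity (\int[PUV]_z f z).
  by rewrite ge0_integral_distribution.
transitivity (\int[PU \x PV]_z f z).
  by apply: eq_measure_integral => A mA _; exact/esym/joint_law.
rewrite fubini_tonelli1//.
transitivity (\int[PU]_x ((`|x|%R)%:E * \int[PV]_y (`|y|%R)%:E)).
  apply: eq_integral => x _; rewrite /fubini_F/= /f/=.
  under eq_integral do rewrite normrM EFinM.
  by rewrite ge0_integralZl_EFin.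
rewrite ge0_integralZr//; last exact: integral_ge0.
by rewrite !ge0_integral_distribution.
Qed.

Lemma integrable_prod : P.-integrable setT (EFin \o U) -> P.-integrable setT (EFin \o V) ->
  P.-integrable setT (fun w => (U w * V w)%:E).
Proof.
move=> iU iV; apply/integrableP; split.
  by apply/measurable_EFinP; exact: measurable_funM.
rewrite [ltLHS]expectation_prod_abs lte_mul_pinfty//.
- exact: integral_ge0.
- rewrite ge0_fin_numE; last exact: integral_ge0.
  by have /integrableP[] := iU.
- by have /integrableP[] := iV.
Qed.

Lemma expectation_prod : P.-integrable setT (EFin \o U) -> P.-integrable setT (EFin \o V) ->
  \int[P]_w (U w * V w)%:E = (\int[P]_w (U w)%:E) * (\int[P]_w (V w)%:E).
Proof.
move=> iU iV; pose f (z : R * R) : \bar R := (z.1 * z.2)%:E.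
have mf : measurable_fun setT f.
  by apply/measurable_EFinP; exact: measurable_funM.
have iUV := integrable_prod iU iV.
have EV : \int[PV]_y y%:E = \int[P]_w (V w)%:E by rewrite integral_distribution.
have EVfin : \int[P]_w (V w)%:E \is a fin_num by exact: integrable_fin_num.
transitivity (\int[PUV]_z f z).
  by rewrite integral_distribution.
transitivity (\int[PU \x PV]_z f z).
  by apply: eq_measure_integral => A mA _; exact/esym/joint_law.
have if_ : (PU \x PV)%E.-integrable setT f.
  apply/integrableP; split => //.
  rewrite (eq_measure_integral PUV); last by move=> A mA _; exact: joint_law.
  rewrite ge0_integral_distribution//; last exact: measurableT_comp.
  by have /integrableP[] := iUV.
rewrite -integral12_prod_meas1//.
transitivity (\int[PU]_x (x%:E * \int[P]_w (V w)%:E)).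
  apply: eq_integral => x _; rewrite /fubini_F/= /f/=.
  under eq_integral do rewrite EFinM.
  by rewrite integralZl// ?EV//; exact: integrable_pushforward.
rewrite -(fineK EVfin) integralZr//; last exact: integrable_pushforward.
by rewrite integral_distribution.
Qed.

End product_expectation.

Section block_expectation.
Context {d} {Omega : measurableType d} {R : realType} (P : probability Omega R).
Context {I : finType} (X : I -> Omega -> R).
Hypothesis mX : forall k, measurable_fun setT (X k).
Hypothesis indX : mutually_independent P X.
Context (J : pred I) (U V : Omega -> R).
Hypothesis mU : measurable_fun setT (U : g_sigma_algebraType (cylinders X J) -> R).
Hypothesis mV : measurable_fun setT (V : g_sigma_algebraType (cylinders X (predC J)) -> R).

Let mU' : measurable_fun setT U.
Proof. exact: block_measurable_fun_measurable mU. Qed.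

Let mV' : measurable_fun setT V.
Proof. exact: block_measurable_fun_measurable mV. Qed.

Let indUV (A B : set R) : measurable A -> measurable B ->
  P (U @^-1` A `&` V @^-1` B) = (P (U @^-1` A) * P (V @^-1` B))%E.
Proof.
move=> mA mB; apply: (block_indep mX indX (J := J)).
  by have := mU measurableT mA; rewrite setTI.
by have := mV measurableT mB; rewrite setTI.
Qed.

Local Open Scope ereal_scope.

Lemma block_ge0_expectation_prod : (forall w, 0 <= U w)%R -> (forall w, 0 <= V w)%R ->
  \int[P]_w (U w * V w)%:E = (\int[P]_w (U w)%:E) * (\int[P]_w (V w)%:E).
Proof.
move=> U0 V0; have := expectation_prod_abs mU' mV' indUV.
under eq_integral do rewrite ger0_norm ?mulr_ge0//.
under [X in X * _]eq_integral do rewrite ger0_norm//.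
by under [X in _ * X]eq_integral do rewrite ger0_norm//.
Qed.

Lemma block_integrable_prod :
  P.-integrable setT (EFin \o U) -> P.-integrable setT (EFin \o V) ->
  P.-integrable setT (fun w => (U w * V w)%:E).
Proof. exact: integrable_prod mU' mV' indUV. Qed.

Lemma block_expectation_prod :
  P.-integrable setT (EFin \o U) -> P.-integrable setT (EFin \o V) ->
  \int[P]_w (U w * V w)%:E = (\int[P]_w (U w)%:E) * (\int[P]_w (V w)%:E).
Proof. exact: expectation_prod mU' mV' indUV. Qed.

End block_expectation.

(** * Restricted isometry constants via a lattice net *)

Section restricted_isometry.
Context {R : realType}.

Lemma sqnorm_ge0 k (v : 'cV[R]_k) : 0 <= sqnorm v.
Proof. by apply: sumr_ge0 => i _; exact: sqr_ge0. Qed.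

Lemma sqnormZ k (a : R) (v : 'cV[R]_k) : sqnorm (a *: v) = a ^+ 2 * sqnorm v.
Proof. by rewrite /sqnorm mulr_sumr; apply: eq_bigr => i _; rewrite mxE exprMn. Qed.

Lemma sqnorm_eq0 k (v : 'cV[R]_k) : sqnorm v = 0 -> v = 0.
Proof.
move=> /eqP; rewrite psumr_eq0 => [/allP H|i _]; last exact: sqr_ge0.
apply/colP => i; rewrite mxE; apply/eqP; rewrite -sqrf_eq0.
by apply: H; rewrite mem_index_enum.
Qed.

(** A quadratic form, hence usable off the unit sphere, where the combinations in the polarization
    live. *)
Definition rip_defect k N (B : 'M[R]_(k, N)) (z : 'cV[R]_N) : R :=
  sqnorm (B *m z) - sqnorm z.

Lemma rip_defectZ k N (B : 'M[R]_(k, N)) a z :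
  rip_defect B (a *: z) = a ^+ 2 * rip_defect B z.
Proof. by rewrite /rip_defect -scalemxAr !sqnormZ mulrBr. Qed.

(** With [a = u - v] and [b = u + v] the two vectors are [8 a + b] and [8 a - b]. The factor 8
    balances the bounds 1/4 on the norm of [a] and 2 on that of [b] available for net points. *)
Let sqnorm_polar k (u v : 'cV[R]_k) : sqnorm u - sqnorm v =
  (sqnorm (9 *: u - 7 *: v) - sqnorm (7 *: u - 9 *: v)) / 32.
Proof.
rewrite /sqnorm -!sumrB mulr_suml; apply: eq_bigr => i _; rewrite !mxE.
by field.
Qed.

Lemma rip_defect_polar k N (B : 'M[R]_(k, N)) (z y : 'cV[R]_N) :
  rip_defect B z - rip_defect B y =
  (rip_defect B (9 *: z - 7 *: y) - rip_defect B (7 *: z - 9 *: y)) / 32.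
Proof.
have := sqnorm_polar (B *m z) (B *m y); have := sqnorm_polar z y.
rewrite /rip_defect !mulmxBr -!scalemxAr.
by move=> H1 H2; lra.
Qed.

Lemma l0E N (z : 'cV[R]_N) : l0 z = #|[pred j | z j 0 != 0]|.
Proof. by apply: eq_card => j; apply/idP/idP => [/set_mem//|H]; exact/mem_set. Qed.

Lemma l0_sub N (z y : 'cV[R]_N) : (forall j, z j 0 = 0 -> y j 0 = 0) ->
  (l0 y <= l0 z)%N.
Proof.
move=> H; rewrite !l0E; apply: subset_leq_card; apply/fintype.subsetP => j.
by rewrite !inE; apply: contra_neq; exact: H.
Qed.

Definition rip_bound k N (s : nat) (B : 'M[R]_(k, N)) (mu : R) : Prop :=
  forall z : 'cV[R]_N, (l0 z <= s)%N -> `|rip_defect B z| <= mu * sqnorm z.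

(** A crude constant that starts the iteration over the net and shows the set defining [ric] to be
    nonempty. *)
Lemma exists_rip_bound k N s (B : 'M[R]_(k, N)) : exists2 mu, 0 <= mu & rip_bound s B mu.
Proof.
pose M := \sum_(i < k) (\sum_(j < N) `|B i j|) ^+ 2.
have M0 : 0 <= M by apply: sumr_ge0 => i _; exact: sqr_ge0.
exists (M + 1); first lra.
move=> z _; have z0 := sqnorm_ge0 z; have Bz0 := sqnorm_ge0 (B *m z).
have HM : sqnorm (B *m z) <= M * sqnorm z.
  rewrite [leLHS]/sqnorm mulr_suml; apply: ler_sum => i _.
  rewrite -(sqr_sqrtr z0) -exprMn -real_normK ?num_real//.
  rewrite ler_sqr ?nnegrE//; last first.
    by rewrite mulr_ge0 ?sqrtr_ge0//; exact: sumr_ge0.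
  rewrite mxE (le_trans (ler_norm_sum _ _ _))// mulr_suml.
  apply: ler_sum => j _; rewrite normrM ler_wpM2l//.
  rewrite -sqrtr_sqr ler_sqrt// /sqnorm (bigD1 j)//= lerDl.
  by apply: sumr_ge0 => l _; exact: sqr_ge0.
by rewrite /rip_defect ler_norml; apply/andP; split; nra.
Qed.

Lemma ric_le k N s (B : 'M[R]_(k, N)) dl : (0 < N)%N -> (0 < s)%N ->
  rip_bound s B dl -> ric s B <= dl.
Proof.
move=> N0 s0 HB; pose e : 'cV[R]_N := delta_mx (Ordinal N0) 0.
have e1 : sqnorm e = 1.
  rewrite /sqnorm (bigD1 (Ordinal N0))//= big1 ?mxE ?eqxx ?expr1n ?addr0// => i iN.
  by rewrite mxE (negbTE iN) expr0n.
have el0 : (l0 e <= s)%N.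
  apply: leq_trans s0; rewrite l0E -[leqRHS](card1 (Ordinal N0)).
  apply: subset_leq_card; apply/fintype.subsetP => j; rewrite !inE mxE.
  by case: (j == Ordinal N0) => //=; rewrite ?mulr0n ?eqxx.
(* The set must be bounded below: the unit vector [e] forces [1 - x <= 1 + x] for each member
   [x]. *)
apply: ge_inf; first by exists 0 => x /(_ e e1 el0) [H1 H2]; lra.
move=> z z1 zs; have := HB z zs; rewrite /rip_defect z1 mulr1 ler_norml.
by move=> /andP[H1 H2]; split; lra.
Qed.

End restricted_isometry.

(** * A lattice net for sparse unit vectors *)

Local Notation net_index N s := {ffun 'I_N -> option (bool * 'I_(4 * s))}.

Section lattice_net.
Context {R : realType}.

(** [None] codes 0 and [Some (b, k)] a signed integer of magnitude [k + 1], so each integer of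
    magnitude at most [M] has exactly one code. *)
Definition net_val (M : nat) (o : option (bool * 'I_M)) : R :=
  if o is Some (b, k) then (-1) ^+ b * k.+1%:R else 0.

Definition net_mag (M : nat) (o : option (bool * 'I_M)) : nat :=
  if o is Some (b, k) then k.+1 else 0.

Lemma net_val_sqr M (o : option (bool * 'I_M)) : net_val o ^+ 2 = (net_mag o)%:R ^+ 2.
Proof. by case: o => [[b k]|]; rewrite /= ?expr0n// exprMn sqrr_sign mul1r. Qed.

(** Truncating toward zero, rather than to the nearest integer, never increases a magnitude, which
    keeps net points in the unit ball. *)
Lemma round_toward_zero (M : nat) (x : R) : `|x| <= M%:R ->
  exists o : option (bool * 'I_M),
  [/\ (x - net_val o) ^+ 2 <= 1, (x + net_val o) ^+ 2 <= 4 * x ^+ 2,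
      (net_mag o)%:R <= `|x| & x = 0 -> o = None].
Proof.
move=> xM; have [t0|t0] := posnP (Num.truncn `|x|).
  exists None; rewrite /= subr0 addr0.
  have x1 : `|x| < 1 by have := truncnS_gt `|x|; rewrite t0.
  have : 0 <= x ^+ 2 by exact: sqr_ge0.
  have : x ^+ 2 <= 1.
    by rewrite -real_normK ?num_real// expr_le1// ltW.
  by move=> ? ?; split => //; lra.
have [tx xt] : (Num.truncn `|x|)%:R <= `|x| /\ `|x| < (Num.truncn `|x|).+1%:R.
  by have /andP[] := truncn_itv (normr_ge0 x).
have tM : ((Num.truncn `|x|).-1 < M)%N.
  by rewrite prednK// -(@ler_nat R) (le_trans tx).
exists (Some (x < 0, Ordinal tM)).
rewrite /= prednK//; set t := (Num.truncn `|x|) in tx xt *.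
have t1 : 1 <= t%:R :> R by rewrite ler1n.
move: xt; rewrite -natr1; have [x0|x0] := ltP x 0.
  rewrite ltr0_norm// in tx * => xt; rewrite expr1; split => //; [nra|nra|].
  by move=> x00; rewrite x00 ltxx in x0.
rewrite ger0_norm// in tx * => xt; rewrite expr0; split => //; [nra|nra|].
by move=> x00; exfalso; rewrite x00 in tx; lra.
Qed.

Definition net_point (N s : nat) (f : net_index N s) : 'cV[R]_N :=
  \col_j (net_val (f j) / (4 * Num.sqrt s%:R)).

(** The l1 bound on the integer coordinates is what allows counting with geometric weights. *)
Definition in_net (N s : nat) (f : net_index N s) : bool :=
  (#|[pred j | f j != None]| <= s)%N && (\sum_j net_mag (f j) <= 4 * s)%N.


(** On the lattice of mesh [1 / (4 sqrt s)], each of at most [s] nonzero coordinates moves by at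
    most one mesh: a squared error of at most [s / (16 s)]. *)
Lemma sparse_approx (N s : nat) (z : 'cV[R]_N) : (0 < s)%N ->
  sqnorm z = 1 -> (l0 z <= s)%N ->
  exists f : net_index N s, [/\ in_net f, sqnorm (z - net_point f) <= 1 / 16,
    sqnorm (z + net_point f) <= 4, sqnorm (net_point f : 'cV[R]_N) <= 1 &
    forall j, z j 0 = 0 -> net_point f j 0 = 0].
Proof.
move=> s0 z1 zs; set q : R := 4 * Num.sqrt s%:R.
have s1 : 1 <= s%:R :> R by rewrite ler1n.
have q2 : q ^+ 2 = 16 * s%:R by rewrite exprMn sqr_sqrtr; lra.
have q0 : 0 < q by rewrite mulr_gt0// sqrtr_gt0; lra.
have zj j : z j 0 ^+ 2 <= 1.
  rewrite -z1 /sqnorm (bigD1 j)//= lerDl.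
  by apply: sumr_ge0 => l _; exact: sqr_ge0.
have qz j : `|q * z j 0| <= (4 * s)%:R.
  rewrite -ler_sqr ?nnegrE// real_normK ?num_real// exprMn q2 natrM.
  by have := zj j; have := sqr_ge0 (z j 0); nra.
have [g Hg] := choice (fun j => round_toward_zero (qz j)).
exists (finfun g); split.
- apply/andP; split.
    apply: leq_trans zs; rewrite l0E; apply: subset_leq_card.
    apply/fintype.subsetP => j; rewrite !inE ffunE; apply: contra_neq => z0.
    by have [_ _ _] := Hg j; apply; rewrite z0 mulr0.
  rewrite -(@ler_nat R) natr_sum.
  apply: (@le_trans _ _ (\sum_(j < N) (2 * (z j 0 != 0)%:R + 2 * s%:R * z j 0 ^+ 2))).
    apply: ler_sum => j _; rewrite ffunE; have [_ _ + H0] := Hg j.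
    have [z0|z0] := eqVneq (z j 0) 0; first by rewrite H0 ?z0 ?mulr0//= ; lra.
    rewrite normrM (ger0_norm (ltW q0)) => /le_trans; apply.
    (* AM-GM: [4 sqrt s |z_j| <= 2 + 2 s z_j ^ 2] *)
    have zz := real_normK (num_real (z j 0)).
    have : 0 <= (q * `|z j 0| - 4) ^+ 2 by exact: sqr_ge0.
    rewrite (_ : _ ^+ 2 = q ^+ 2 * `|z j 0| ^+ 2 - 8 * (q * `|z j 0|) + 16); last by ring.
    by rewrite zz q2 /= => ?; lra.
  rewrite big_split/= -!mulr_sumr -/(sqnorm z) z1 natrM mulr1.
  rewrite -natr_sum -big_mkcond/= sum1_card.
  have : (#|[pred j | z j 0 != 0]|)%:R <= s%:R :> R by rewrite ler_nat -l0E.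
  by move=> H; lra.
- rewrite /sqnorm; apply: (@le_trans _ _ (\sum_(j < N) ((z j 0 != 0)%:R / (16 * s%:R)))).
    apply: ler_sum => j _; rewrite !mxE ffunE -/q.
    have [H1 _ _ H0] := Hg j.
    have [z0|z0] := eqVneq (z j 0) 0.
      by rewrite H0 ?z0 ?mulr0//= mul0r subr0 expr0n/= mul0r.
    rewrite (_ : z j 0 - _ = (q * z j 0 - net_val (g j)) / q); last by field; lra.
    by rewrite expr_div_n q2 ler_pM2r ?invr_gt0//; lra.
  rewrite -mulr_suml -natr_sum -big_mkcond/= sum1_card.
  have : (#|[pred j | z j 0 != 0]|)%:R <= s%:R :> R by rewrite ler_nat -l0E.
  by move=> H; rewrite ler_pdivrMr; lra.
- apply: (@le_trans _ _ (4 * sqnorm z)); last by rewrite z1 mulr1.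
  rewrite /sqnorm mulr_sumr; apply: ler_sum => j _.
  rewrite !mxE ffunE -/q; have [_ H2 _ _] := Hg j.
  rewrite (_ : z j 0 + _ = (q * z j 0 + net_val (g j)) / q); last by field; lra.
  rewrite expr_div_n ler_pdivrMr ?exprn_gt0// (le_trans H2)//.
  by rewrite (_ : 4 * (q * z j 0) ^+ 2 = 4 * z j 0 ^+ 2 * q ^+ 2)//; ring.
- rewrite -z1 /sqnorm; apply: ler_sum => j _; rewrite mxE ffunE -/q expr_div_n.
  have [_ _ H3 _] := Hg j.
  rewrite ler_pdivrMr ?exprn_gt0// (mulrC _ (q ^+ 2)) -exprMn net_val_sqr.
  by rewrite -[leRHS]real_normK ?num_real// lerXn2r ?nnegrE.
- move=> j z0; rewrite mxE ffunE; have [_ _ _ H0] := Hg j.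
  by rewrite H0 ?z0 ?mulr0//= mul0r.
Qed.

(** Polarize between a unit vector [z] and its net point [y]. Both combinations are supported in the
    support of [z], so [mu] applies to them, and their squared norms add up to at most
    [128 / 16 + 2 * 4 = 16], half of the denominator 32. *)
Lemma rip_bound_improve k N s (B : 'M[R]_(k, N)) (al mu : R) : (0 < s)%N ->
  0 <= mu -> (forall f : net_index N s, in_net f -> sqnorm (net_point f : 'cV[R]_N) <= 1 ->
    `|rip_defect B (net_point f)| <= al) ->
  rip_bound s B mu -> rip_bound s B (al + mu / 2).
Proof.
move=> s0 mu0 Hnet Hmu.
have unit z : (l0 z <= s)%N -> sqnorm z = 1 -> `|rip_defect B z| <= al + mu / 2.
  move=> zs z1; have [f [fnet d1 d2 y1 supp]] := sparse_approx s0 z1 zs.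
  move: (net_point f) d1 d2 supp (Hnet f fnet y1) => {y1} y d1 d2 supp Hy.
  have Hcomb a b : (l0 (a *: z - b *: y) <= s)%N.
    apply: leq_trans zs; apply: l0_sub => j z0.
    by rewrite !mxE z0 supp// !mulr0 subr0.
  have := Hmu _ (Hcomb 9 7); have := Hmu _ (Hcomb 7 9).
  have E : sqnorm (9 *: z - 7 *: y) + sqnorm (7 *: z - 9 *: y) =
      128 * sqnorm (z - y) + 2 * sqnorm (z + y).
    rewrite /sqnorm !mulr_sumr -!big_split/=; apply: eq_bigr => j _.
    by rewrite !mxE; ring.
  have := rip_defect_polar B z y; move: Hy.
  rewrite !ler_norml => /andP[h1 h2] h3 /andP[h4 h5] /andP[h6 h7].
  by apply/andP; split; nra.
move=> z zs; have [z0|z0] := eqVneq (sqnorm z) 0.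
  rewrite (sqnorm_eq0 z0) /rip_defect mulmx0.
  rewrite (_ : sqnorm 0 = 0); last by rewrite /sqnorm big1// => i _; rewrite mxE expr0n.
  rewrite (_ : sqnorm 0 = 0); last by rewrite /sqnorm big1// => i _; rewrite mxE expr0n.
  by rewrite subr0 normr0 mulr0.
have zp : 0 < sqnorm z by rewrite lt_neqAle eq_sym z0 sqnorm_ge0.
pose a := (Num.sqrt (sqnorm z))^-1.
have a2 : a ^+ 2 = (sqnorm z)^-1 by rewrite exprVn sqr_sqrtr// ltW.
have := unit (a *: z); rewrite sqnormZ a2 mulVf// rip_defectZ a2 => H.
have /H/(_ erefl) : (l0 (a *: z) <= s)%N.
  by apply: leq_trans zs; apply: l0_sub => j; rewrite mxE => ->; rewrite mulr0.
by rewrite normrM gtr0_norm ?invr_gt0// ler_pdivrMl// mulrC.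
Qed.

(** The map sending [mu] to [al + mu / 2] is a contraction with fixed point [2 * al]; iterating the
    improvement from a crude constant converges to it. *)
Lemma rip_bound_net k N s (B : 'M[R]_(k, N)) (al : R) : (0 < s)%N ->
  (forall f : net_index N s, in_net f -> sqnorm (net_point f : 'cV[R]_N) <= 1 ->
    `|rip_defect B (net_point f)| <= al) ->
  rip_bound s B (2 * al).
Proof.
move=> s0 Hnet; have [mu mu0 Hmu] := exists_rip_bound s B.
have al0 : 0 <= al.
  apply: le_trans (Hnet [ffun=> None] _ _) => //.
    apply/andP; split; first by rewrite eq_card0// => j; rewrite !inE ffunE.
    by rewrite big1// => j _; rewrite ffunE.
  by rewrite /sqnorm big1// => j _; rewrite mxE ffunE/= mul0r expr0n.
have Hn n : rip_bound s B (2 * al + mu / 2 ^+ n).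
  elim: n => [|n IHn].
    by move=> z zs; rewrite expr0 divr1 (le_trans (Hmu z zs))// ler_wpM2r ?sqnorm_ge0//; lra.
  have e0 : 0 <= 2 * al + mu / 2 ^+ n by rewrite addr_ge0 ?divr_ge0 ?exprn_ge0//; lra.
  have := rip_bound_improve s0 e0 Hnet IHn.
  rewrite (_ : al + _ = 2 * al + mu / 2 ^+ n.+1)//.
  by rewrite exprS; field; rewrite expf_neq0.
move=> z zs; apply/ler_addgt0Pr => e e0.
(* Chosen so that [2 ^ n >= n > mu * sqnorm z / e], which brings the remaining error below [e]. *)
pose n := (Num.truncn (mu * sqnorm z / e)).+1.
apply: le_trans (Hn n z zs) _; rewrite mulrDl lerD2l.
have n2 : n%:R <= 2 ^+ n :> R by rewrite -natrX ler_nat ltnW// ltn_expl.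
have := truncnS_gt (mu * sqnorm z / e); rewrite -/n => /lt_le_trans/(_ n2).
rewrite ltr_pdivrMr// => /ltW H.
by rewrite mulrAC ler_pdivrMr ?exprn_gt0// (mulrC e).
Qed.

Lemma ric_lt_of_net k N s (B : 'M[R]_(k, N)) (delta : R) : (0 < N)%N -> (0 < s)%N ->
  0 < delta ->
  (forall f : net_index N s, in_net f -> sqnorm (net_point f : 'cV[R]_N) <= 1 ->
    `|rip_defect B (net_point f)| <= delta / 4) ->
  ric s B < delta.
Proof.
move=> N0 s0 d0 /(rip_bound_net s0)/(ric_le N0 s0)/le_lt_trans; apply; lra.
Qed.

End lattice_net.

(** * Cardinality of the net *)

Section net_cardinality.
Context {R : realType}.

(** [None] weighs 1, and each sign contributes [t] times a geometric sum of first term and ratio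
    1/2. *)
Let sum_option_weight (M : nat) (t : R) : 0 <= t ->
  \sum_(o : option (bool * 'I_M)) t ^+ (o != None) * 2^-1 ^+ net_mag o <= 1 + 2 * t.
Proof.
move=> t0; rewrite (bigD1 None)//= !expr0 mulr1 lerD2l.
rewrite (reindex_omap Some id)/=; last by case.
rewrite (eq_big xpredT (fun p : bool * 'I_M => t * 2^-1 ^+ p.2.+1)); last 2 first.
- by move=> p; rewrite eqxx.
- by case=> b k _; rewrite expr1.
rewrite -(pair_bigA _ (fun (b : bool) (k : 'I_M) => t * 2^-1 ^+ k.+1))/=.
rewrite sumr_const card_bool -[leLHS]mulr_natl ler_pM2l// -mulr_sumr ler_piMr//.
have -> : \sum_(i < M) 2^-1 ^+ i.+1 = 1 - 2^-1 ^+ M :> R.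
  elim: M => [|M IHM]; first by rewrite big_ord0 expr0 subrr.
  by rewrite big_ord_recr/= IHM exprS; field.
by rewrite lerBlDr lerDl exprn_ge0.
Qed.

(* Generating function: each net point has weight at least [(s / N) ^ s / 16 ^ s], while
   the total weight factors over the coordinates. *)
Lemma card_net N s : (0 < s)%N -> (s <= N)%N ->
  (#|[pred f : net_index N s | in_net f]|)%:R <=
  (expR 1 * N%:R / s%:R) ^+ s * (16 * expR 1) ^+ s :> R.
Proof.
(* With this weight per nonzero coordinate, the total is at most
   [(1 + 2 t) ^ N <= exp (2 t N) = exp (2 s)]. *)
move=> s0 sN; pose t : R := s%:R / N%:R.
have s0' : 0 < s%:R :> R by rewrite ltr0n.
have N0' : 0 < N%:R :> R by rewrite ltr0n (leq_trans s0).
have t0 : 0 < t by rewrite divr_gt0.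
have t0' := ltW t0.
have t1 : t <= 1 by rewrite ler_pdivrMr// mul1r ler_nat.
pose w (o : option (bool * 'I_(4 * s))) : R := t ^+ (o != None) * 2^-1 ^+ net_mag o.
have w0 o : 0 <= w o by rewrite mulr_ge0 ?exprn_ge0.
have h0 : 0 <= t ^+ s * 2^-1 ^+ (4 * s) :> R by rewrite mulr_ge0 ?exprn_ge0.
have weight f : in_net f -> t ^+ s * 2^-1 ^+ (4 * s) <= \prod_j w (f j).
  move=> /andP[f1 f2]; rewrite /w big_split/= !prodrXr ler_pM ?exprn_ge0//.
    rewrite ler_wiXn2l//; apply: leq_trans f1.
    by rewrite -sum1_card [leqRHS]big_mkcond.
  by rewrite ler_wiXn2l//; lra.
have total : \sum_(f : net_index N s) \prod_j w (f j) <= expR (2 * s%:R).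
  rewrite -(bigA_distr_bigA (fun _ o => w o))/= prodr_const card_ord.
  apply: (@le_trans _ _ ((1 + 2 * t) ^+ N)).
    by rewrite lerXn2r ?nnegrE ?sumr_ge0 ?sum_option_weight//; lra.
  apply: (@le_trans _ _ (expR (2 * t) ^+ N)).
    by rewrite lerXn2r ?nnegrE ?expR_ge0 ?expR_ge1Dx//; lra.
  rewrite -expRM_natl (_ : N%:R * _ = 2 * s%:R)// /t; field.
  exact: lt0r_neq0.
have : (#|[pred f : net_index N s | in_net f]|)%:R * (t ^+ s * 2^-1 ^+ (4 * s)) <= expR (2 * s%:R).
  apply: le_trans total; rewrite mulr_natl -sumr_const big_mkcond/=.
  apply: ler_sum => f _; rewrite inE; case: ifP => [/weight//|_].
  exact: prodr_ge0.
rewrite -ler_pdivlMr; last by rewrite mulr_gt0 ?exprn_gt0.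
move=> /le_trans; apply; rewrite expRM_natr exprM -!exprMn -exprVn -exprMn.
rewrite (_ : 2 = 1 + 1 :> R)// expRD le_eqVlt; apply/orP; left; apply/eqP; congr (_ ^+ _).
by rewrite /t; field; rewrite !lt0r_neq0.
Qed.

End net_cardinality.

(** * Squares of subGaussian variables *)

Section subgaussian_square.
Context {d} {Omega : measurableType d} {R : realType} (P : probability Omega R).

Let geometric_half_sum n : \sum_(0 <= k < n) 2^-1 ^+ k <= 2 :> R.
Proof.
have -> : \sum_(0 <= k < n) 2^-1 ^+ k = 2 - 2 * 2^-1 ^+ n :> R.
  elim: n => [|n IHn]; first by rewrite big_nil expr0 mulr1 subrr.
  by rewrite big_nat_recr//= IHn exprS; field.
have : 0 <= 2^-1 ^+ n :> R by rewrite exprn_ge0.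
lra.
Qed.

Let expRN_sqr_le_half k : expR (- k%:R ^+ 2) <= 2^-1 ^+ k :> R.
Proof.
apply: (@le_trans _ _ (expR (k%:R * -1))).
  by rewrite ler_expR mulrN1 lerN2 -natrX ler_nat; case: k => // k; rewrite leq_pmulr.
rewrite expRM_natl lerXn2r ?nnegrE ?expR_ge0// expRN lef_pV2 ?posrE ?expR_gt0//.
by have := expR_ge1Dx (1 : R).
Qed.

(* Discrete substitute for Gaussian mixing: the best integer [k] near [|x| / (2 b)]
   makes [k |x| - b k ^ 2] at least [x ^ 2 / (4 b) - b]. *)
Let sqr_exponent_le (b x : R) : 0 < b -> exists k : nat,
  x ^+ 2 / (4 * b) <= b + (k%:R * `|x| - b * k%:R ^+ 2).
Proof.
move=> b0; pose u := `|x| / (2 * b); have u0 : 0 <= u by rewrite divr_ge0//; lra.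
have /andP[] := truncn_itv u0; rewrite -natr1; set n := Num.truncn u => n1 n2.
exists n; have xu : `|x| = 2 * b * u by rewrite /u; field; rewrite lt0r_neq0.
rewrite -real_normK ?num_real// xu.
rewrite (_ : (2 * b * u) ^+ 2 / _ = b * u ^+ 2); last by field; rewrite lt0r_neq0.
have : (u - n%:R) ^+ 2 <= 1 by rewrite expr_le1//; lra.
by nra.
Qed.

Local Open Scope ereal_scope.

(** The quadratic exponent is dominated by a series of linear exponents [k |Y| - b k ^ 2] with
    [b = c + 1]. SubGaussianity bounds the [k]-th expectation by a multiple of
    [exp (c k ^ 2 - b k ^ 2) = exp (- k ^ 2)], which is summable. *)
Lemma subGaussian_sqr_exp_moment (c : R) (Y : Omega -> R) : (0 < c)%R ->
  measurable_fun setT Y -> subGaussian P c Y ->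
  \int[P]_w (expR (Y w ^+ 2 / (4 * (c + 1))))%:E <= (4 * expR (c + 1))%:E.
Proof.
move=> c0 mY sY; pose b : R := (c + 1)%R; have b0 : (0 < b)%R by rewrite /b; lra.
pose g (k : nat) w : R := (expR (b - b * k%:R ^+ 2) *
  (expR (k%:R * Y w) + expR (- k%:R * Y w)))%R.
have mexp (t : R) : measurable_fun setT (fun w => expR (t * Y w)).
  by apply: measurableT_comp => //; exact: measurable_funM.
have mg k : measurable_fun setT (g k).
  by apply: measurable_funM => //; exact: measurable_funD.
have g0 k w : (0 <= g k w)%R by rewrite mulr_ge0 ?addr_ge0 ?expR_ge0.
apply: (@le_trans _ _ (\int[P]_w \sum_(0 <= k <oo) (g k w)%:E)).
  apply: ge0_le_integral => //.
  - apply/measurable_EFinP; apply: measurableT_comp => //.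
    by apply: measurable_funM => //; exact: measurable_funX.
  - apply: ge0_emeasurable_sum => [k w _ _|k _]; first by rewrite lee_fin.
    exact/measurable_EFinP.
  move=> w _; have [n Hn] := sqr_exponent_le (Y w) b0.
  apply: le_trans (nneseries_lim_ge n.+1 _) => //; last by move=> *; rewrite lee_fin.
  rewrite big_nat_recr//= -[leLHS]add0e leeD//.
    by apply: sume_ge0 => k _; rewrite lee_fin.
  rewrite lee_fin /g -/b [leRHS]mulrDr -!expRD.
  have [Y0|Y0] := leP 0%R (Y w).
    rewrite ger0_norm// in Hn; apply: (@le_trans _ _ (expR (b - b * n%:R ^+ 2 + n%:R * Y w))).
      by rewrite ler_expR; lra.
    by rewrite lerDl expR_ge0.
  rewrite ltr0_norm// in Hn; apply: (@le_trans _ _ (expR (b - b * n%:R ^+ 2 + - n%:R * Y w))).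
    by rewrite ler_expR; lra.
  by rewrite lerDr expR_ge0.
rewrite integral_nneseries//; last 2 first.
- by move=> k; exact/measurable_EFinP.
- by move=> k w _; rewrite lee_fin.
have Hg k : \int[P]_w (g k w)%:E <= (2 * expR b * 2^-1 ^+ k)%:E.
  rewrite /g; under eq_integral do rewrite EFinM.
  have e0 t w : 0 <= (expR (t * Y w))%:E by rewrite lee_fin expR_ge0.
  have mE t : measurable_fun setT (fun w => (expR (t * Y w))%:E) by exact/measurable_EFinP.
  have mS : measurable_fun setT (fun w => (expR (k%:R * Y w) + expR (- k%:R * Y w))%:E).
    by apply/measurable_EFinP; exact: measurable_funD.
  have S0 w : 0 <= (expR (k%:R * Y w) + expR (- k%:R * Y w))%:E.
    by rewrite lee_fin addr_ge0 ?expR_ge0.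
  rewrite ge0_integralZl_EFin ?expR_ge0//.
  under eq_integral do rewrite EFinD.
  rewrite ge0_integralD//.
  have := leeD (sY k%:R) (sY (- k%:R)%R); rewrite sqrrN => H.
  apply: (@le_trans _ _ ((expR (b - b * k%:R ^+ 2))%:E *
      ((expR (c * k%:R ^+ 2))%:E + (expR (c * k%:R ^+ 2))%:E))).
    by rewrite lee_wpmul2l// lee_fin expR_ge0.
  rewrite -EFinD -EFinM lee_fin -mulr2n -[X in (_ * X)%R]mulr_natl mulrCA -expRD.
  rewrite (_ : (_ + _)%R = (b + - k%:R ^+ 2)%R); last by rewrite /b; ring.
  by rewrite expRD -!mulrA ler_pM2l// ler_pM2l ?expR_gt0.
apply: lime_le.
  by apply: is_cvg_nneseries => k _ _; apply: integral_ge0 => w _; rewrite lee_fin.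
near=> n.
apply: (@le_trans _ _ (\sum_(0 <= k < n) (2 * expR b * 2^-1 ^+ k)%:E)).
  exact: lee_sum.
rewrite sumEFin lee_fin -mulr_sumr.
have := geometric_half_sum n; have := expR_gt0 b; rewrite -/b; nra.
Unshelve. all: by end_near. Qed.


(** For [u >= 0], use [exp u <= 1 + u exp u] twice; for [u < 0],
    [exp u <= 1 / (1 - u) <= 1 + u + u ^ 2]. *)
Let expR_le_quadratic (u : R) : (expR u <= 1 + u + u ^+ 2 * expR `|u|)%R.
Proof.
have [u0|u0] := leP 0%R u.
  rewrite ger0_norm//.
  have h1 := expR_ge1Dx (- u); have e0 := expR_gt0 u.
  have : (expR u * expR (- u) = 1)%R by rewrite expRxMexpNx_1.
  have : (expR u * (1 - u) <= expR u * expR (- u))%R by rewrite ler_pM2l.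
  by move=> h2 h3; nra.
rewrite ltr0_norm//.
have h1 := expR_ge1Dx u; have h2 := expR_ge1Dx (- u); have e0 := expR_gt0 u.
have h3 : (expR u * expR (- u) = 1)%R by rewrite expRxMexpNx_1.
have h4 : (expR u * (1 - u) <= 1)%R by rewrite -[leRHS]h3 ler_pM2l.
have h5 : (u ^+ 2 <= u ^+ 2 * expR (- u))%R by rewrite ler_peMr ?sqr_ge0//; lra.
by nra.
Qed.

(** Half of the rate [1 / (4 (c + 1))] at which [Y ^ 2] has a bounded exponential moment; the other
    half pays for the quadratic factor of the remainder. *)
Definition square_scale (c : R) : R := (8 * (c + 1))^-1.

Definition square_variance_proxy (c : R) : R :=
  4 / square_scale c ^+ 2 * expR (2 * square_scale c) * (4 * expR (c + 1)).

Lemma square_scale_gt0 c : (0 < c)%R -> (0 < square_scale c)%R.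
Proof. by move=> c0; rewrite invr_gt0; lra. Qed.

Lemma square_variance_proxy_gt0 c : (0 < c)%R -> (0 < square_variance_proxy c)%R.
Proof.
move=> c0; have l0 := square_scale_gt0 c0.
by rewrite !mulr_gt0 ?expR_gt0// invr_gt0 exprn_gt0.
Qed.

(** Integrate a second-order expansion of the exponential: the linear term cancels because [v] is
    the second moment, and the remainder is at most a multiple of [l ^ 2] times
    [exp (Y ^ 2 / (4 (c + 1)))]. *)
Lemma subGaussian_centered_square_mgf (c v l : R) (Y : Omega -> R) : (0 < c)%R ->
  (0 <= v <= 1)%R -> (`|l| <= square_scale c)%R ->
  measurable_fun setT Y -> subGaussian P c Y -> \int[P]_w (Y w ^+ 2)%:E = v%:E ->
  \int[P]_w (expR (l * (Y w ^+ 2 - v)))%:E <= (expR (square_variance_proxy c * l ^+ 2))%:E.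
Proof.
move=> c0 /andP[v0 v1] ll mY sY Yv; set l0 := square_scale c in ll *.
have l00 : (0 < l0)%R by exact: square_scale_gt0.
pose E w : R := expR (Y w ^+ 2 / (4 * (c + 1))).
have a0E : ((4 * (c + 1))^-1 = 2 * l0)%R.
  by rewrite /l0 /square_scale; field; rewrite lt0r_neq0//; lra.
pose k1 : R := (4 / l0 ^+ 2 * expR (2 * l0))%R.
have k10 : (0 < k1)%R by rewrite !mulr_gt0 ?expR_gt0// invr_gt0 exprn_gt0.
have pw w : (expR (l * (Y w ^+ 2 - v)) <= (1 - l * v) + (l * Y w ^+ 2 + l ^+ 2 * k1 * E w))%R.
  set q := (Y w ^+ 2)%R; have q0 : (0 <= q)%R by exact: sqr_ge0.
  set u := (l * (q - v))%R.
  have ut : (`|u| <= l0 * (q + 1))%R.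
    rewrite normrM ler_pM// ler_norml; apply/andP; split; lra.
  have u2 : (u ^+ 2 <= l ^+ 2 * (q + 1) ^+ 2)%R.
    by rewrite /u exprMn ler_wpM2l ?sqr_ge0//; nra.
  (* This is [x ^ 2 <= exp (2 x)] at [x = l0 (q + 1) / 2]. *)
  have t2 : ((q + 1) ^+ 2 <= 4 / l0 ^+ 2 * expR (l0 * (q + 1)))%R.
    have := expR_ge1Dx (l0 * (q + 1) / 2) => h.
    have h' : (l0 * (q + 1) / 2 <= expR (l0 * (q + 1) / 2))%R by lra.
    have : ((l0 * (q + 1) / 2) ^+ 2 <= expR (l0 * (q + 1) / 2) ^+ 2)%R.
      by rewrite lerXn2r ?nnegrE ?expR_ge0// divr_ge0// mulr_ge0//; lra.
    rewrite -expRM_natl (_ : (2 * _)%R = (l0 * (q + 1))%R); last by field.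
    move=> h2; rewrite mulrAC ler_pdivlMr ?exprn_gt0//.
    rewrite (_ : ((l0 * (q + 1) / 2) ^+ 2 = (q + 1) ^+ 2 * l0 ^+ 2 / 4)%R) in h2; last by field.
    by lra.
  have eu : (expR `|u| <= expR (l0 * (q + 1)))%R by rewrite ler_expR.
  apply: (le_trans (expR_le_quadratic u)).
  suff : (u ^+ 2 * expR `|u| <= l ^+ 2 * k1 * E w)%R by rewrite /u; lra.
  rewrite /k1 /E -/q a0E.
  apply: (@le_trans _ _ (l ^+ 2 * (q + 1) ^+ 2 * expR (l0 * (q + 1)))%R).
    by rewrite ler_pM ?sqr_ge0 ?expR_ge0.
  apply: (@le_trans _ _ (l ^+ 2 * (4 / l0 ^+ 2 * expR (l0 * (q + 1))) * expR (l0 * (q + 1)))%R).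
    by rewrite ler_wpM2r ?expR_ge0// ler_wpM2l ?sqr_ge0.
  (* The two factors [exp (l0 (q + 1))] make up [E w] times [exp (2 l0)], whence the latter in the
     variance proxy. *)
  have -> : (expR (q * (2 * l0)) = expR (l0 * (q + 1)) * expR (l0 * (q + 1)) / expR (2 * l0))%R.
    by rewrite -expRN -!expRD; congr expR; ring.
  rewrite le_eqVlt; apply/orP; left; apply/eqP; field.
  by rewrite !lt0r_neq0 ?expR_gt0.
have mY2 : measurable_fun setT (fun w => (Y w ^+ 2)%R) by exact: measurable_funX.
have mE : measurable_fun setT E.
  by apply: measurableT_comp => //; exact: measurable_funM.
have HE := subGaussian_sqr_exp_moment c0 mY sY.
have E0 w : (0 <= E w)%R by exact: expR_ge0.
have iY2 : P.-integrable setT (fun w => (Y w ^+ 2)%:E).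
  apply/integrableP; split; first exact/measurable_EFinP.
  under eq_integral do rewrite gee0_abs ?lee_fin ?sqr_ge0//.
  by rewrite Yv ltry.
have iE : P.-integrable setT (fun w => (E w)%:E).
  apply/integrableP; split; first exact/measurable_EFinP.
  under eq_integral do rewrite gee0_abs ?lee_fin//.
  by rewrite (le_lt_trans HE)// ltry.
apply: (@le_trans _ _ (\int[P]_w ((1 - l * v)%:E +
    (l%:E * (Y w ^+ 2)%:E + (l ^+ 2 * k1)%:E * (E w)%:E)))).
  apply: ge0_le_integral => //.
  - apply/measurable_EFinP; apply: measurableT_comp => //.
    by apply: measurable_funM => //; exact: measurable_funB.
  - apply/measurable_EFinP; apply: measurable_funD => //.
    by apply: measurable_funD; exact: measurable_funM.
  - by move=> w _; rewrite -!EFinM -!EFinD lee_fin.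
rewrite integralD//; last 2 first.
- exact: finite_measure_integrable_cst.
- by apply: integrableD => //; exact: integrableZl.
rewrite integralD//; [|exact: integrableZl|exact: integrableZl].
have -> : \int[P]_w (1 - l * v)%:E = (1 - l * v)%:E.
  by rewrite integral_cst// -[RHS]mule1; congr *%E; exact: probability_setT.
rewrite !integralZl// Yv.
apply: (@le_trans _ _ ((1 - l * v)%:E + (l%:E * v%:E + (l ^+ 2 * k1)%:E * (4 * expR (c + 1))%:E))).
  by rewrite leeD2l// leeD2l// lee_wpmul2l// lee_fin mulr_ge0 ?sqr_ge0 ?ltW.
rewrite -!EFinM -!EFinD lee_fin.
apply: le_trans (expR_ge1Dx _); rewrite /square_variance_proxy -/l0 -/k1; lra.
Qed.

End subgaussian_square.

(** * Linear combinations of independent subGaussian variables *)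

Section block_products.
Context {d} {Omega : measurableType d} {R : realType} (P : probability Omega R).
Context {I : finType} (X : I -> Omega -> R).
Hypothesis mX : forall k, measurable_fun setT (X k).
Hypothesis indX : mutually_independent P X.

Lemma cylinders_sub (J J' : pred I) : subpred J J' -> cylinders X J `<=` cylinders X J'.
Proof.
move=> JJ' _ [B mB ->]; exists (fun k => if J k then B k else setT).
  by move=> k; case: ifP.
apply/seteqP; split=> w /= H k; first by move=> _; case: ifP => // /H.
by move=> Jk; have := H k (JJ' _ Jk); rewrite Jk.
Qed.

Lemma block_measurable_fun_sub (J J' : pred I) (U : Omega -> R) : subpred J J' ->
  measurable_fun setT (U : g_sigma_algebraType (cylinders X J) -> R) ->
  measurable_fun setT (U : g_sigma_algebraType (cylinders X J') -> R).
Proof.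
move=> JJ' mU _ B mB; have := mU measurableT B mB.
by apply: sub_smallest2r; [exact: smallest_sigma_algebra|exact: cylinders_sub].
Qed.

Local Open Scope ereal_scope.

(** Induction on the list: the first factor depends on its own block, the remaining product on the
    complement of that block. *)
Lemma block_ge0_expectation_bigprod {T : eqType} (J : T -> pred I) (W : T -> Omega -> R)
    (r : seq T) :
  (forall i j k, i != j -> J i k -> ~~ J j k) ->
  (forall i, measurable_fun setT (W i : g_sigma_algebraType (cylinders X (J i)) -> R)) ->
  (forall i w, 0 <= W i w)%R -> uniq r ->
  \int[P]_w (\prod_(i <- r) W i w)%:E = \prod_(i <- r) \int[P]_w (W i w)%:E.
Proof.
move=> disJ mW W0; elim: r => [_|i r IHr /= /andP[ir ur]].
  rewrite big_nil; under eq_integral do rewrite big_nil.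
  by rewrite integral_cst// mul1e; exact: probability_setT.
under eq_integral do rewrite big_cons.
rewrite big_cons -IHr//; apply: (block_ge0_expectation_prod mX indX (J := J i)) => //.
  (* Replacing the factor of index [i], absent from [r], by 1 makes every factor measurable for the
     complementary block. *)
  have -> : (fun w => \prod_(j <- r) W j w)%R =
      (fun w => \prod_(j <- r) (if j == i then cst 1%R else W j) w)%R.
    apply/funext => w; apply: eq_big_seq => j jr.
    by case: eqP => // ji; rewrite -ji jr in ir.
  apply: (@measurable_prod _ (g_sigma_algebraType (cylinders X (predC (J i))))) => j _.
  case: eqP => // /eqP ji; apply: (@block_measurable_fun_sub (J j)) => // k Jjk /=.
  exact: disJ Jjk.
by move=> w; exact: prodr_ge0.
Qed.

End block_products.

Lemma lee_prod_seq {R : realType} {T : eqType} (r : seq T) (f g : T -> \bar R) :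
  (forall i, i \in r -> 0 <= f i <= g i)%E ->
  (0 <= \prod_(i <- r) f i <= \prod_(i <- r) g i)%E.
Proof.
elim: r => [_|i r IHr H]; first by rewrite !big_nil lee_fin ler01 lexx.
have /andP[f0 fg] := H i (mem_head _ _).
have /andP[p0 pq] : (0 <= \prod_(i <- r) f i <= \prod_(i <- r) g i)%E.
  by apply: IHr => j jr; apply: H; rewrite inE jr orbT.
by rewrite !big_cons mule_ge0//= lee_pmul.
Qed.

Section linear_combinations.
Context {d} {Omega : measurableType d} {R : realType} (P : probability Omega R).
Context {I : finType} (X : I -> Omega -> R).
Hypothesis mX : forall k, measurable_fun setT (X k).
Hypothesis indX : mutually_independent P X.
Context (c : R) (a : I -> R).

Definition lincomb (r : seq I) (w : Omega) : R := \sum_(k <- r) a k * X k w.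

Lemma block_measurable_lincomb (J : pred I) r : {in r, forall k, J k} ->
  measurable_fun setT (lincomb r : g_sigma_algebraType (cylinders X J) -> R).
Proof.
move=> rJ.
have -> : lincomb r =
    (fun w => \sum_(k <- r) (if J k then (fun w => a k * X k w) else cst 0) w).
  by apply/funext => w; apply: eq_big_seq => k /rJ ->.
apply: (@measurable_sum _ (g_sigma_algebraType (cylinders X J))) => k.
case: ifP => // Jk; apply: measurable_funM => //; exact: block_measurable_fun.
Qed.

Lemma measurable_lincomb r : measurable_fun setT (lincomb r).
Proof. by apply: measurable_sum => k; exact: measurable_funM. Qed.

Local Open Scope ereal_scope.

(** The exponential factors over single variables, so the moment generating functions multiply and
    the parameters [c a_k ^ 2] add up. *)
Lemma subGaussian_lincomb r : uniq r ->
  (forall k, k \in r -> subGaussian_entry P c (X k)) ->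
  subGaussian P (c * \sum_(k <- r) a k ^+ 2) (lincomb r).
Proof.
move=> ur sX t; under eq_integral do rewrite mulr_sumr expR_sum.
rewrite (block_ge0_expectation_bigprod mX indX (J := fun k => pred1 k)
   (W := fun k w => expR (t * (a k * X k w))))//.
- rewrite mulrAC mulr_sumr expR_sum -prodEFin.
  suff /andP[] : 0 <= \prod_(i <- r) \int[P]_w (expR (t * (a i * X i w)))%:E <=
      \prod_(i <- r) (expR (c * t ^+ 2 * a i ^+ 2))%:E by [].
  apply: lee_prod_seq => k kr; apply/andP; split.
    by apply: integral_ge0 => w _; rewrite lee_fin expR_ge0.
  have [_ _ _ _ /(_ (t * a k)%R)] := sX k kr.
  rewrite exprMn mulrA; under eq_integral do rewrite -mulrA.
  by [].
- by move=> i j k ij /= /eqP ->.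
- move=> i; apply: measurableT_comp => //; apply: measurable_funM => //.
  apply: measurable_funM => //; apply: block_measurable_fun => /=; exact: eqxx.
Qed.

(** Induction on the list: in the square of [a_k X_k + S] the cross term has mean zero, by
    independence and centring. *)
Lemma lincomb_moments r : uniq r ->
  (forall k, k \in r -> subGaussian_entry P c (X k)) ->
  [/\ P.-integrable setT (EFin \o lincomb r), \int[P]_w (lincomb r w)%:E = 0,
      P.-integrable setT (fun w => (lincomb r w ^+ 2)%:E) &
      \int[P]_w (lincomb r w ^+ 2)%:E = (\sum_(k <- r) a k ^+ 2)%:E].
Proof.
elim: r => [_ _|k r IHr /= /andP[kr ur] sX].
  have l0 : lincomb [::] = cst 0%R by apply/funext => w; rewrite /lincomb big_nil.
  rewrite l0 big_nil; split.
  - exact: integrable0.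
  - exact: integral0.
  - by rewrite /= expr0n/=; exact: integrable0.
  - by rewrite /= expr0n/=; exact: integral0.
have [iS S0 iS2 S2] : [/\ P.-integrable setT (EFin \o lincomb r), \int[P]_w (lincomb r w)%:E = 0,
      P.-integrable setT (fun w => (lincomb r w ^+ 2)%:E) &
      \int[P]_w (lincomb r w ^+ 2)%:E = (\sum_(k <- r) a k ^+ 2)%:E].
  by apply: IHr => // l lr; apply: sX; rewrite inE lr orbT.
have [_ iX X0 X2 _] := sX k (mem_head _ _).
have iX2 : P.-integrable setT (fun w => (X k w ^+ 2)%:E).
  apply/integrableP; split; first by apply/measurable_EFinP; exact: measurable_funX.
  under eq_integral do rewrite gee0_abs ?lee_fin ?sqr_ge0//.
  by rewrite X2 ltry.
have mXk : measurable_fun setT (X k : g_sigma_algebraType (cylinders X (pred1 k)) -> R).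
  by apply: block_measurable_fun => /=.
have mS : measurable_fun setT
    (lincomb r : g_sigma_algebraType (cylinders X (predC (pred1 k))) -> R).
  apply: block_measurable_lincomb => l lr /=; apply: contraNneq kr => <-//.
have iXS := block_integrable_prod mX indX mXk mS iX iS.
have XS0 := block_expectation_prod mX indX mXk mS iX iS.
rewrite X0 mul0e in XS0.
have E1 w : (lincomb (k :: r) w)%:E = (a k)%:E * (X k w)%:E + (lincomb r w)%:E.
  by rewrite /lincomb big_cons EFinD EFinM.
have E2 w : (lincomb (k :: r) w ^+ 2)%:E = (a k ^+ 2)%:E * (X k w ^+ 2)%:E +
    ((2 * a k)%:E * (X k w * lincomb r w)%:E + (lincomb r w ^+ 2)%:E).
  by rewrite /lincomb big_cons -!EFinM -!EFinD; congr EFin; ring.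
have iaX : P.-integrable setT (fun w => (a k)%:E * (X k w)%:E) by exact: integrableZl.
have iaX2 : P.-integrable setT (fun w => (a k ^+ 2)%:E * (X k w ^+ 2)%:E) by exact: integrableZl.
have iaXS : P.-integrable setT (fun w => (2 * a k)%:E * (X k w * lincomb r w)%:E).
  exact: integrableZl.
have i2 : P.-integrable setT
    (fun w => (2 * a k)%:E * (X k w * lincomb r w)%:E + (lincomb r w ^+ 2)%:E).
  exact: integrableD.
split.
- by under [X in _.-integrable _ X]funext do rewrite /= E1; exact: integrableD.
- under eq_integral do rewrite E1.
  by rewrite integralD// integralZl// X0 S0 mule0 adde0.
- by under [X in _.-integrable _ X]funext do rewrite E2; exact: integrableD.
- under eq_integral do rewrite E2.
  rewrite integralD// integralD// !integralZl// X2 XS0 S2 mule0 add0e mule1.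
  by rewrite big_cons EFinD.
Qed.

End linear_combinations.

(** * Chernoff bound with erasures *)

Section erasure_chernoff.
Context {d} {Omega : measurableType d} {R : realType} (P : probability Omega R).
Context {m N : nat} (X : ('I_m * 'I_N + 'I_m)%type -> Omega -> R) (c p : R).
Hypothesis c0 : 0 < c.
Hypothesis sX : forall ij, subGaussian_entry P c (X (inl ij)).
Hypothesis mT : forall i, measurable_fun setT (X (inr i)).
Hypothesis PT : forall i, P [set w | X (inr i) w = 1] = p%:E.
Hypothesis indX : mutually_independent P X.

Let mX k : measurable_fun setT (X k).
Proof. by case: k => [ij|i]; [case: (sX ij)|exact: mT]. Qed.

Definition measurement (y : 'cV[R]_N) (i : 'I_m) (w : Omega) : R :=
  \sum_j y j 0 * X (inl (i, j)) w.

Definition observed (i : 'I_m) : set Omega := [set w | X (inr i) w = 1].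

(** A row of entries together with its erasure indicator; distinct rows give disjoint blocks. *)
Definition row_block (i : 'I_m) : pred ('I_m * 'I_N + 'I_m)%type :=
  fun k => match k with inl (i', _) => i' == i | inr i' => i' == i end.

Let row_seq (i : 'I_m) : seq ('I_m * 'I_N + 'I_m)%type :=
  [seq inl (i, j) | j <- index_enum 'I_N].

Let coef (y : 'cV[R]_N) (k : ('I_m * 'I_N + 'I_m)%type) : R :=
  if k is inl (_, j) then y j 0 else 0.

Let measurementE y i : measurement y i = lincomb X (coef y) (row_seq i).
Proof. by apply/funext => w; rewrite /lincomb big_map. Qed.

Let uniq_row_seq i : uniq (row_seq i).
Proof. by rewrite map_inj_uniq ?index_enum_uniq// => j j' []. Qed.

Let sum_coef y i : \sum_(k <- row_seq i) coef y k ^+ 2 = sqnorm y.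
Proof. by rewrite big_map. Qed.

Lemma measurable_measurement y i : measurable_fun setT (measurement y i).
Proof. by rewrite measurementE; exact: measurable_lincomb. Qed.

Lemma measurement_square_mgf y i (l : R) : sqnorm y <= 1 -> `|l| <= square_scale c ->
  (\int[P]_w (expR (l * (measurement y i w ^+ 2 - sqnorm y)))%:E <=
   (expR (square_variance_proxy c * l ^+ 2))%:E)%E.
Proof.
move=> y1 ll.
have rX k : k \in row_seq i -> subGaussian_entry P c (X k) by move=> /mapP[j _ ->].
have [_ _ _] := lincomb_moments mX indX (coef y) (uniq_row_seq i) rX.
have := subGaussian_lincomb mX indX (coef y) (uniq_row_seq i) rX.
rewrite -measurementE sum_coef => sY Y2.
apply: subGaussian_centered_square_mgf => //.
- by rewrite sqnorm_ge0.
- exact: measurable_measurement.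
move=> t; apply: (le_trans (sY t)); rewrite lee_fin ler_expR ler_wpM2r ?sqr_ge0//.
by rewrite -[leRHS]mulr1 ler_pM2l.
Qed.

(** The share of row [i] in the Chernoff exponent. An erased row gives 0, hence a factor 1, and an
    observed one pays [tau], so the random number of observed rows disappears from the threshold,
    which becomes 0. *)
Definition tilt (y : 'cV[R]_N) (l tau : R) (i : 'I_m) (w : Omega) : R :=
  \1_(observed i) w * (l * (measurement y i w ^+ 2 - sqnorm y) - tau).

Let observed_cylinder i : cylinders X (row_block i) (observed i).
Proof.
by apply: (preimage_in_cylinders X (k := inr i) (B := [set 1])) => //=; exact: measurable_set1.
Qed.

Let measurable_observed i : measurable (observed i).
Proof. exact: (cylinders_measurable mX (observed_cylinder i)). Qed.

Lemma block_measurable_tilt y l tau i :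
  measurable_fun setT (tilt y l tau i : g_sigma_algebraType (cylinders X (row_block i)) -> R).
Proof.
apply: measurable_funM.
  by apply: measurable_indic; apply: sub_sigma_algebra; exact: observed_cylinder.
apply: measurable_funB => //; apply: measurable_funM => //; apply: measurable_funB => //.
apply: measurable_funX; rewrite measurementE.
by apply: block_measurable_lincomb => k /mapP[j _ ->] /=; exact: eqxx.
Qed.

Local Open Scope ereal_scope.

(** Split on whether the row is observed; the observation event is independent of the entries, so
    its probability [p] factors out. *)
Lemma tilt_mgf y l tau i : (sqnorm y <= 1)%R -> (`|l| <= square_scale c)%R ->
  \int[P]_w (expR (tilt y l tau i w))%:E <=
  (1 - p + p * expR (square_variance_proxy c * l ^+ 2 - tau))%:E.
Proof.
move=> y1 ll; pose G w : R := expR (l * (measurement y i w ^+ 2 - sqnorm y)).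
have mG : measurable_fun setT G.
  apply: measurableT_comp => //; apply: measurable_funM => //; apply: measurable_funB => //.
  exact/measurable_funX/measurable_measurement.
have G0 w : (0 <= G w)%R by exact: expR_ge0.
have E w : (expR (tilt y l tau i w))%:E =
    (\1_(~` observed i) w)%:E + (expR (- tau))%:E * (\1_(observed i) w * G w)%:E.
  rewrite /tilt /G !indicE in_setC -EFinM -EFinD; congr EFin.
  case: (w \in observed i) => /=; last by rewrite !mul0r expR0 mulr0 addr0.
  by rewrite !mul1r add0r -expRD addrC.
have mO : measurable_fun setT (fun w => (\1_(~` observed i) w : R)%:E).
  by apply/measurable_EFinP; apply: measurable_indic; exact: measurableC.
have mOG : measurable_fun setT (fun w => (\1_(observed i) w * G w)%:E).
  by apply/measurable_EFinP; apply: measurable_funM => //; exact: measurable_indic.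
have OG0 w : 0 <= (\1_(observed i) w * G w)%:E by rewrite lee_fin mulr_ge0.
under eq_integral do rewrite E.
rewrite ge0_integralD//; last 2 first.
- by move=> w _; rewrite mule_ge0// lee_fin expR_ge0.
- by apply: emeasurable_funM.
rewrite ge0_integralZl_EFin ?expR_ge0//.
rewrite integral_indic//; last exact: measurableC.
rewrite setIT.
have -> : \int[P]_w (\1_(observed i) w * G w)%:E = p%:E * \int[P]_w (G w)%:E.
  rewrite (block_ge0_expectation_prod mX indX (J := pred1 (inr i))) => //.
  - congr (_ * _); rewrite integral_indic//.
    by rewrite setIT; exact: PT.
  - apply: measurable_indic; apply: sub_sigma_algebra.
    apply: (preimage_in_cylinders X (k := inr i) (B := [set 1%R])); first exact: eqxx.
    exact: measurable_set1.
  - apply: measurableT_comp => //; apply: measurable_funM => //; apply: measurable_funB => //.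
    apply: measurable_funX; rewrite measurementE.
    by apply: block_measurable_lincomb => k /mapP[j _ ->].
have p0 : (0 <= p)%R by rewrite -lee_fin -(PT i).
have PO : P (~` observed i) = (1 - p)%:E.
  by rewrite probability_setC// EFinB; congr (_ - _); exact: PT.
rewrite [X in X + _](_ : _ = (1 - p)%:E); last exact: PO.
rewrite [leRHS]EFinD leeD2l//.
apply: (@le_trans _ _ ((expR (- tau))%:E * (p%:E * (expR (square_variance_proxy c * l ^+ 2))%:E))).
  rewrite lee_wpmul2l ?lee_fin ?expR_ge0// lee_wpmul2l//.
  exact: measurement_square_mgf.
by rewrite -!EFinM lee_fin expRD mulrCA (mulrC (expR (- tau))).
Qed.

(** Bound the indicator of the event by the exponential of the sum, whose expectation factors over
    the row blocks. *)
Lemma tilt_sum_prob y l tau : (sqnorm y <= 1)%R -> (`|l| <= square_scale c)%R ->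
  measurable [set w | 0 <= \sum_i tilt y l tau i w]%R /\
  P [set w | 0 <= \sum_i tilt y l tau i w]%R <=
  ((1 - p + p * expR (square_variance_proxy c * l ^+ 2 - tau)) ^+ m)%:E.
Proof.
move=> y1 ll; set Ev := [set w | _].
have mt i : measurable_fun setT (tilt y l tau i).
  by apply: (block_measurable_fun_measurable mX (J := row_block i)); exact: block_measurable_tilt.
have mS : measurable_fun setT (fun w => \sum_i tilt y l tau i w)%R by exact: measurable_sum.
have mEv : measurable Ev.
  rewrite /Ev (_ : [set _ | _] = (fun w => \sum_i tilt y l tau i w)%R @^-1` `[0%R, +oo[%classic).
    by rewrite -[_ @^-1` _]setTI; exact: mS.
  by apply/seteqP; split => w /=; rewrite in_itv/= andbT.
split => //.
have mW i : measurable_fun setT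
    ((fun w => expR (tilt y l tau i w)) : g_sigma_algebraType (cylinders X (row_block i)) -> R).
  by apply: measurableT_comp => //; exact: block_measurable_tilt.
apply: (@le_trans _ _ (\int[P]_w (\prod_i expR (tilt y l tau i w))%:E)).
  rewrite -[X in P X]setIT -integral_indic//; apply: ge0_le_integral => //.
  - by apply/measurable_EFinP; exact: measurable_indic.
  - apply/measurable_EFinP; under eq_fun do rewrite -expR_sum.
    exact: measurableT_comp.
  - move=> w _; rewrite lee_fin -expR_sum indicE; case: (boolP (w \in Ev)) => [|_].
      by move=> /set_mem /= h; apply: le_trans (expR_ge1Dx _); rewrite lerDl.
    exact: expR_ge0.
rewrite (block_ge0_expectation_bigprod mX indX (J := row_block)
   (W := fun i w => expR (tilt y l tau i w)))//.
- rewrite (_ : (_ ^+ m)%R =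
      \prod_(i < m) (1 - p + p * expR (square_variance_proxy c * l ^+ 2 - tau)))%R; last first.
    by rewrite prodr_const card_ord.
  rewrite -prodEFin.
  suff /andP[] : 0 <= \prod_(i < m) \int[P]_w (expR (tilt y l tau i w))%:E <=
    \prod_(i < m) (1 - p + p * expR (square_variance_proxy c * l ^+ 2 - tau))%:E by [].
  apply: lee_prod_seq.
  move=> i _; rewrite tilt_mgf// andbT; apply: integral_ge0 => w _.
  by rewrite lee_fin expR_ge0.
- move=> i j k ij; case: k => [[i' j']|i'] /= /eqP ->//.
- exact: index_enum_uniq.
Qed.

End erasure_chernoff.

(** * Measurability of the restricted isometry constant *)

Section ric_density.
Context {R : realType} {k N : nat}.

Definition rat_vec (q : {ffun 'I_N -> rat}) : 'cV[R]_N := \col_j ratr (q j).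

(** Sparse vectors are limits of rational vectors with no larger support, and both sides are
    continuous. *)
Lemma rip_bound_rational s (B : 'M[R]_(k, N)) mu :
  (forall q, (l0 (rat_vec q) <= s)%N ->
     `|rip_defect B (rat_vec q)| <= mu * sqnorm (rat_vec q)) ->
  rip_bound s B mu.
Proof.
move=> Hq z zs.
have ex n j : exists q : rat, `|z j 0 - ratr q| < n.+1%:R^-1 /\ (z j 0 = 0 -> q = 0).
  have [z0|z0] := eqVneq (z j 0) 0.
    by exists 0; rewrite z0 rmorph0 subr0 normr0 invr_gt0.
  have [|q] := @rat_in_itvoo R (z j 0) (z j 0 + n.+1%:R^-1); first by rewrite ltrDl invr_gt0.
  rewrite in_itv/= => /andP[h1 h2]; exists q; split; last by move=> H; rewrite H eqxx in z0.
  by rewrite ltr0_norm ?subr_lt0// opprB ltrBlDl.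
pose g n := projT1 (choice (ex n)).
have Hg n j : `|z j 0 - ratr (g n j)| < n.+1%:R^-1 /\ (z j 0 = 0 -> g n j = 0).
  exact: (projT2 (choice (ex n))).
pose y n := rat_vec (finfun (g n)).
have yE n j : y n j 0 = ratr (g n j) by rewrite mxE ffunE.
have ycvg j : (fun n => y n j 0) @ \oo --> z j 0.
  apply/cvgrPdist_lt => e e0; near=> n; rewrite yE.
  have [h _] := Hg n j; apply: (lt_trans h).
  by near: n; exact: (near_infty_natSinv_lt (PosNum e0)).
have sq_cvg l (C : 'M[R]_(l, N)) : (fun n => sqnorm (C *m y n)) @ \oo --> sqnorm (C *m z).
  have mul_cvg i : (fun n => (C *m y n) i 0) @ \oo --> (C *m z) i 0.
    rewrite mxE; under eq_fun do rewrite mxE.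
    apply: cvg_big => [|j _]; first exact: add_continuous.
    by apply: cvgM => //; exact: cvg_cst.
  apply: cvg_big => [|i _]; first exact: add_continuous.
  by rewrite expr2; under eq_fun do rewrite expr2; exact: cvgM.
have y_cvg : (fun n => sqnorm (y n)) @ \oo --> sqnorm z.
  by have := sq_cvg _ 1%:M; rewrite mul1mx; under eq_fun do rewrite mul1mx.
have c1 : (fun n => `|rip_defect B (y n)|) @ \oo --> `|rip_defect B z|.
  by apply: cvg_norm; exact: cvgB.
have c2 : (fun n => mu * sqnorm (y n)) @ \oo --> mu * sqnorm z.
  by apply: cvgM => //; exact: cvg_cst.
apply: (ler_cvg_to c1 c2).
near=> n; apply: Hq; apply: leq_trans zs; apply: l0_sub => j z0.
by rewrite mxE ffunE; have [_ ->] := Hg n j; rewrite ?rmorph0.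
Unshelve. all: by end_near. Qed.

(** A rational strictly between an admissible constant and [delta] turns the strict bound on an
    infimum into a condition on countably many constants and vectors. *)
Lemma ric_ltP s (B : 'M[R]_(k, N)) (delta : R) : (0 < N)%N -> (0 < s)%N ->
  ric s B < delta <-> exists r : rat, ratr r < delta /\ forall q, (l0 (rat_vec q) <= s)%N ->
     `|rip_defect B (rat_vec q)| <= ratr r * sqnorm (rat_vec q).
Proof.
move=> N0 s0; split; last first.
  by move=> [r [rd /rip_bound_rational/(ric_le N0 s0)/le_lt_trans]]; exact.
move=> /inf_lt[|dl Hdl dld].
  have [mu _ Hmu] := exists_rip_bound s B; exists mu => z z1 /Hmu.
  rewrite /rip_defect z1 mulr1 ler_norml.
  by move=> /andP[H1 H2]; split; lra.
have [r] := rat_in_itvoo dld; rewrite in_itv/= => /andP[h1 h2].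
exists r; split => // q qs; move: (rat_vec q) qs => z zs.
(* The zero vector cannot be normalized; a crude bound shows that its defect vanishes. *)
have z00 := sqnorm_ge0 z; have [z0|z0] := eqVneq (sqnorm z) 0.
  have [mu _ /(_ z zs)] := exists_rip_bound s B.
  by rewrite z0 !mulr0.
have zp : 0 < sqnorm z by rewrite lt_neqAle eq_sym z0.
pose a := (Num.sqrt (sqnorm z))^-1.
have a2 : a ^+ 2 = (sqnorm z)^-1 by rewrite exprVn sqr_sqrtr.
have [||h3 h4] := Hdl (a *: z).
- by rewrite sqnormZ a2 mulVf.
- by apply: leq_trans zs; apply: l0_sub => j; rewrite mxE => ->; rewrite mulr0.
have : `|rip_defect B (a *: z)| <= ratr r.
  by rewrite /rip_defect [sqnorm (a *: z)]sqnormZ a2 mulVf// ler_norml; apply/andP; split; lra.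
by rewrite rip_defectZ a2 normrM gtr0_norm ?invr_gt0// ler_pdivrMl// mulrC.
Qed.

End ric_density.

Section countable_measurability.
Context {d} {Omega : measurableType d} {T : countType}.

Lemma countType_bigcup_measurable (F : T -> set Omega) :
  (forall t, measurable (F t)) -> measurable (\bigcup_t F t).
Proof.
move=> mF; pose G n := if unpickle n is Some t then F t else set0.
rewrite (_ : \bigcup_t F t = \bigcup_n G n).
  by apply: bigcupT_measurable => n; rewrite /G; case: unpickle.
apply/seteqP; split=> w [].
  by move=> t _ Ft; exists (pickle t) => //; rewrite /G pickleK.
by move=> n _; rewrite /G; case: unpickle => // t Ft; exists t.
Qed.

Lemma countType_bigcap_measurable (F : T -> set Omega) :
  (forall t, measurable (F t)) -> measurable (\bigcap_t F t).
Proof.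
move=> mF; rewrite -[X in measurable X]setCK setC_bigcap; apply: measurableC.
by apply: countType_bigcup_measurable => t; exact: measurableC.
Qed.

End countable_measurability.

(** The row count [k w] varies with [w], so measurability is asked of the scalar defects only; the
    countable criterion depends on nothing else. *)
Lemma measurable_ric_lt {d} {Omega : measurableType d} {R : realType} {N s : nat}
    (k : Omega -> nat) (B : forall w, 'M[R]_(k w, N)) (delta : R) :
  (0 < N)%N -> (0 < s)%N ->
  (forall z : 'cV[R]_N, measurable_fun setT (fun w => rip_defect (B w) z)) ->
  measurable [set w | ric s (B w) < delta].
Proof.
move=> N0 s0 mB.
rewrite (_ : [set w | _] = \bigcup_(r : rat) \bigcap_(q : {ffun 'I_N -> rat})
   [set w | ratr r < delta /\ ((l0 (rat_vec q : 'cV[R]_N) <= s)%N ->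
     `|rip_defect (B w) (rat_vec q)| <= ratr r * sqnorm (rat_vec q))]).
  apply: countType_bigcup_measurable => r; apply: countType_bigcap_measurable => q.
  have [rd|rd] := ltP (ratr r) delta; last first.
    rewrite (_ : [set _ | _] = set0)//; by apply/seteqP; split => // w /= [].
  have [qs|qs] := leqP (l0 (rat_vec q : 'cV[R]_N)) s; last first.
    rewrite (_ : [set _ | _] = setT)//; by apply/seteqP; split => // w _ /=; split.
  rewrite (_ : [set _ | _] = (fun w => `|rip_defect (B w) (rat_vec q)|) @^-1`
     `]-oo, ratr r * sqnorm (rat_vec q)]%classic); last first.
    apply/seteqP; split => w /=; rewrite in_itv/=; first by move=> [_ /(_ isT)].
    by move=> h; split.
  rewrite -[_ @^-1` _]setTI.
  by apply: (measurableT_comp (@normr_measurable R setT) (mB (rat_vec q))).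
apply/seteqP; split => w /=.
  move=> /(ric_ltP _ _ N0 s0)[r [rd H]]; exists r => // q _ /=; split => //; exact: H.
move=> [r _ H]; apply/(ric_ltP _ _ N0 s0); exists r.
have [rd _] := H [ffun=> 0] I; split => // q qs.
by have [_] := H q I; exact.
Qed.

(** * Assembling the bounds *)

Lemma measure_bigsetU_le {d} {Omega : measurableType d} {R : realType}
    (P : probability Omega R) {T : Type} (r : seq T) (A : T -> set Omega) :
  (forall t, measurable (A t)) ->
  (P (\big[setU/set0]_(t <- r) A t) <= \sum_(t <- r) P (A t))%E.
Proof.
move=> mA; elim: r => [|t r IHr]; first by rewrite !big_nil measure0.
rewrite !big_cons; apply: (le_trans (measureU2 _ _ _)) => //.
  by apply: bigsetU_measurable.
by rewrite leeD2l.
Qed.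

Section observed_defect.
Context {d} {Omega : measurableType d} {R : realType}.
Context {m N : nat} (X : ('I_m * 'I_N + 'I_m)%type -> Omega -> R).

Definition observed_mx (w : Omega) :=
  normalized_sub [set i | X (inr i) w == 1%R] (\matrix_(i < m, j < N) X (inl (i, j)) w).

Let indic_observed i w : \1_(observed X i) w = (X (inr i) w == 1)%:R :> R.
Proof.
rewrite indicE; congr (_%:R); congr nat_of_bool.
by apply/idP/eqP => [/set_mem//|H]; exact/mem_set.
Qed.

(** Indicators turn a selection of random size into sums over all rows, as needed for tilts and
    measurability. With no observed row, the inverse is 0 by convention. *)
Lemma rip_defect_observed w y : rip_defect (observed_mx w) y =
  (\sum_i \1_(observed X i) w)^-1 * (\sum_i \1_(observed X i) w * measurement X y i w ^+ 2)
    - sqnorm y.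
Proof.
rewrite /rip_defect /observed_mx /normalized_sub -scalemxAl sqnormZ exprVn sqr_sqrtr//.
set T := [set i | _]%SET; congr (_^-1 * _ - _).
  rewrite -sum1_card natr_sum big_mkcond/=; apply: eq_bigr => i _.
  by rewrite indic_observed inE; case: ifP.
transitivity (\sum_(i in T) measurement X y i w ^+ 2); last first.
  rewrite big_mkcond/=; apply: eq_bigr => i _; rewrite indic_observed inE.
  by case: ifP => _; rewrite ?mul1r ?mul0r.
rewrite big_enum_val; apply: eq_bigr => k _; congr (_ ^+ 2); rewrite mxE.
by apply: eq_bigr => j _; rewrite !mxE mulrC.
Qed.

(* If nothing is observed, both sums are [0]. *)
Lemma defect_gt_tilt w y (l dl : R) : 0 <= l -> dl < `|rip_defect (observed_mx w) y| ->
  0 <= \sum_i tilt X y l (l * dl) i w \/ 0 <= \sum_i tilt X y (- l) (l * dl) i w.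
Proof.
move=> l0; rewrite rip_defect_observed.
set n := \sum_i \1_(observed X i) w; set S := \sum_i _ * _.
have E a : \sum_i tilt X y a (l * dl) i w = a * (S - n * sqnorm y) - n * (l * dl).
  rewrite /S /n !mulr_suml -sumrB mulr_sumr -sumrB; apply: eq_bigr => i _.
  by rewrite /tilt; ring.
rewrite !E; have n0 : 0 <= n by apply: sumr_ge0.
have [n1|n1] := eqVneq n 0.
  have S0 : S = 0.
    apply: big1 => i _; suff -> : \1_(observed X i) w = 0 :> R by rewrite mul0r.
    by move/eqP: n1; rewrite psumr_eq0// => /allP/(_ i (mem_index_enum i))/eqP.
  by move=> _; left; rewrite n1 S0 !mul0r !subr0 mulr0.
have np : 0 < n by rewrite lt_neqAle eq_sym n1.
have -> : n^-1 * S - sqnorm y = (S - n * sqnorm y) / n by field.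
rewrite normrM [X in _ * X]gtr0_norm ?invr_gt0// ltr_pdivlMr//.
move: (S - _) => D; have [D0|D0] := leP 0 D.
  by rewrite ger0_norm// => h; left; nra.
by rewrite ltr0_norm// => h; right; nra.
Qed.

Lemma measurable_rip_defect_observed y :
  (forall k, measurable_fun setT (X k)) ->
  measurable_fun setT (fun w => rip_defect (observed_mx w) y).
Proof.
(* The count is nonnegative, so its inverse is the power of exponent -1, a measurable function even
   at 0. *)
move=> mX; under eq_fun do rewrite rip_defect_observed -powR_inv1 ?sumr_ge0//.
have mO i : measurable_fun setT (\1_(observed X i) : Omega -> R).
  apply: measurable_indic; rewrite (_ : observed X i = X (inr i) @^-1` [set 1])//.
  by rewrite -[_ @^-1` _]setTI; apply: mX => //; exact: measurable_set1.
apply: measurable_funB => //; apply: measurable_funM.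
  by apply: (measurableT_comp (measurable_powR _)); exact: measurable_sum.
apply: measurable_sum => i; apply: measurable_funM => //; apply: measurable_funX.
by apply: measurable_sum => j; exact: measurable_funM.
Qed.

End observed_defect.

(** * Arithmetic of the sample size *)

Section sample_size.
Context {R : realType}.

(** The quantity bounded by [eps] is the size bound for the net times two tails [q ^ m]. *)
Lemma union_bound_sample_size (N s m : nat) (eps q : R) : (0 < s)%N -> (s <= N)%N ->
  0 < eps < 1 -> 0 < q < 1 ->
  (ln (1 / q))^-1 * (4 / 3 * s%:R * ln (expR 1 * N%:R / s%:R) + 14 / 3 * s%:R
    + 4 / 3 * ln (2 / eps)) <= m%:R ->
  (expR 1 * N%:R / s%:R) ^+ s * (16 * expR 1) ^+ s * (2 * q ^+ m) <= eps.
Proof.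
move=> s0 sN /andP[eps0 eps1] /andP[q0 q1] Hm.
have s0' : 0 < s%:R :> R by rewrite ltr0n.
have N0' : 0 < N%:R :> R by rewrite ltr0n (leq_trans s0).
set G := expR 1 * N%:R / s%:R in Hm *.
have G0 : 0 < G by rewrite divr_gt0// mulr_gt0// expR_gt0.
have lnG : 1 <= ln G.
  rewrite -[leLHS]expRK ler_ln ?posrE ?expR_gt0// /G -mulrA ler_peMr ?expR_ge0//.
  by rewrite ler_pdivlMr// mul1r ler_nat.
set L := ln (1 / q) in Hm.
have L0 : 0 < L by rewrite ln_gt0// ltr_pdivlMr// mul1r.
have qL : q = expR (- L) by rewrite /L div1r lnV ?posrE// opprK lnK ?posrE.
have e2 : 2 <= expR 1 :> R by have := expR_ge1Dx (1 : R); lra.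
have e16 : 16 <= expR 4 :> R.
  rewrite -[4%:R]mulr1 expRM_natl (_ : 16 = 2 ^+ 4 :> R); last by rewrite -natrX.
  by rewrite lerXn2r ?nnegrE ?expR_ge0.
have lneps : 0 <= ln (2 / eps) by rewrite ln_ge0// ler_pdivlMr//; lra.
have Hm' : 4 / 3 * s%:R * ln G + 14 / 3 * s%:R + 4 / 3 * ln (2 / eps) <= m%:R * L.
  by rewrite -ler_pdivrMr// mulrC.
rewrite -[G in G ^+ s]lnK ?posrE// -expRM_natl.
apply: (@le_trans _ _ (expR (s%:R * ln G) * expR (s%:R * 5) * (2 * expR (m%:R * - L)))).
  rewrite qL -expRM_natl ler_wpM2r ?mulr_ge0 ?expR_ge0// ler_wpM2l ?expR_ge0//.
  rewrite expRM_natl lerXn2r ?nnegrE ?mulr_ge0 ?expR_ge0//.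
  have -> : 5 = 4 + 1 :> R by ring.
  by rewrite expRD ler_wpM2r ?expR_ge0.
rewrite mulrCA -!expRD.
(* Since [ln G >= 1], the spare third of [s ln G] and [14 / 3 * s] cover the [5 s] that comes from
   [16 e <= exp 5]. *)
apply: (@le_trans _ _ (2 * expR (- ln (2 / eps)))).
  by rewrite ler_pM2l// ler_expR; nra.
by rewrite expRN lnK ?posrE ?divr_gt0// invf_div mulrC divfK.
Qed.

End sample_size.

(* Random family: inl (i,j) = entry A_{ij}; inr i = indicator (0/1) of i \in T. *)
Theorem theorem1 (R : realType) (c : R) (hc : 0 < c) :
  exists C : R, 0 < C /\
  forall (N s m : nat) (p eps delta : R)
    (d : measure_display) (Omega : measurableType d) (P : probability Omega R)
    (X : ('I_m * 'I_N + 'I_m)%type -> Omega -> R),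
    (0 < N)%N -> (0 < s)%N -> (0 < m)%N -> (s <= N)%N ->
    0 <= p <= 1 -> 0 < eps -> 0 < delta < 1 ->
    (forall ij, subGaussian_entry P c (X (inl ij))) ->
    (forall i, measurable_fun setT (X (inr i))) ->
    (forall i, P [set w | X (inr i) w = 1] = p%:E) ->
    (forall i, P [set w | X (inr i) w = 0] = (1 - p)%:E) ->
    mutually_independent P X ->
    0 < p ->
    (m%:R >= (ln (1 / (1 - p + p * expR (- C * delta ^+ 2))))^-1 *
       (4 / 3 * s%:R * ln (expR 1 * N%:R / s%:R) + 14 / 3 * s%:R
        + 4 / 3 * ln (2 / eps))) ->
    ((1 - eps)%:E <=
      P [set w | (ric s (normalized_sub [set i | X (inr i) w == 1%R]
                          (\matrix_(i < m, j < N) X (inl (i, j)) w)) < delta)%R])%E.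
Proof.
pose K := square_variance_proxy c; have K0 : 0 < K := square_variance_proxy_gt0 hc.
have K8 : 0 < 8 * K by rewrite pmulr_rgt0.
(* The first bound keeps [l = eta * delta] in the range of the moment estimate; the second makes
   [K l ^ 2] at most half of [tau = eta * delta ^ 2 / 4]. The other half of [tau] is
   [C * delta ^ 2]. *)
pose eta := Num.min (square_scale c) (8 * K)^-1.
have eta0 : 0 < eta by rewrite lt_min square_scale_gt0// invr_gt0.
have eta_scale : eta <= square_scale c by rewrite ge_min lexx.
have etaK : K * eta <= 1 / 8.
  have : eta <= (8 * K)^-1 by rewrite ge_min lexx orbT.
  by rewrite -[leRHS]div1r ler_pdivlMr// => h; lra.
exists (eta / 8); split; first by rewrite divr_gt0.
move=> N s m p eps delta d Omega P X N0 s0 _ sN /andP[p0 p1] eps0 /andP[delta0 delta1].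
move=> sX mT PT _ indX p_gt0 Hm.
have mX k : measurable_fun setT (X k).
  by case: k => [ij|i]; [case: (sX ij)|exact: mT].
pose good := [set w | ric s (observed_mx X w) < delta].
have mgood : measurable good.
  by apply: measurable_ric_lt => // y; exact: measurable_rip_defect_observed.
change ((1 - eps)%:E <= P good)%E.
(* For [eps >= 1] the claimed lower bound is not positive. *)
have [eps1|eps1] := leP 1 eps.
  by apply: (@le_trans _ _ 0%E) => //; rewrite lee_fin; lra.
pose q := 1 - p + p * expR (- (eta / 8) * delta ^+ 2).
have e1 : expR (- (eta / 8) * delta ^+ 2) < 1.
  by rewrite -expR0 ltr_expR mulNr oppr_lt0 mulr_gt0 ?exprn_gt0// divr_gt0.
have q0 : 0 < q by have := expR_gt0 (- (eta / 8) * delta ^+ 2); rewrite /q; nra.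
have q1 : q < 1 by rewrite /q; nra.
(* [delta / 4] is the deviation tolerated on the net. *)
pose l := eta * delta; pose tau := l * (delta / 4).
have l0 : 0 <= l by rewrite mulr_ge0// ltW.
have ll : `|l| <= square_scale c.
  by rewrite ger0_norm//; apply: le_trans eta_scale; rewrite /l ler_piMr// ltW.
have exponent : K * l ^+ 2 - tau <= - (eta / 8) * delta ^+ 2.
  have : K * eta * (eta * delta ^+ 2) <= 1 / 8 * (eta * delta ^+ 2).
    by rewrite ler_wpM2r// mulr_ge0 ?sqr_ge0// ltW.
  by rewrite /tau /l; lra.
have tail (l' : R) (y : 'cV[R]_N) : `|l'| <= square_scale c -> l' ^+ 2 = l ^+ 2 ->
    sqnorm y <= 1 -> measurable [set w | 0 <= \sum_i tilt X y l' tau i w] /\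
    (P [set w | 0 <= \sum_i tilt X y l' tau i w]%R <= (q ^+ m)%:E)%E.
  move=> ll' l2 y1; have [mE /le_trans PE] := tilt_sum_prob hc sX mT PT indX tau y1 ll'.
  split=> //; apply: PE; rewrite lee_fin l2 lerXn2r ?nnegrE ?(ltW q0)//.
    by rewrite addr_ge0 ?mulr_ge0 ?expR_ge0//; lra.
  by rewrite lerD2l ler_pM2l// ler_expR.
(* The two signs of [l] handle upper and lower deviations; only points of the unit ball count, as
   the moment estimate requires. *)
pose bad (f : net_index N s) : set Omega :=
  if in_net f && (sqnorm (net_point f : 'cV[R]_N) <= 1) then
    [set w | 0 <= \sum_i tilt X (net_point f) l tau i w] `|`
    [set w | 0 <= \sum_i tilt X (net_point f) (- l) tau i w]
  else set0.
have mbad f : measurable (bad f).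
  rewrite /bad; case: ifP => // /andP[_ y1].
  by apply: measurableU; apply: (tail _ _ _ _ y1).1; rewrite ?normrN ?sqrrN.
have Pbad f : (P (bad f) <= ((in_net f)%:R * (2 * q ^+ m))%:E)%E.
  rewrite /bad; case: ifP => [/andP[-> y1]|_]; last first.
    by rewrite measure0 lee_fin !mulr_ge0// exprn_ge0// ltW.
  have [m1 P1] := tail l _ ll erefl y1.
  have [||m2 P2] := tail (- l) _ _ _ y1; rewrite ?normrN ?sqrrN//.
  apply: (le_trans (measureU2 P m1 m2)); apply: (le_trans (leeD P1 P2)).
  by rewrite -EFinD lee_fin mul1r mulr_natl mulr2n.
pose Bad := \big[setU/set0]_(f : net_index N s) bad f.
have mBad : measurable Bad by apply: bigsetU_measurable.
have PBad : (P Bad <= eps%:E)%E.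
  apply: (le_trans (measure_bigsetU_le P _ mbad)).
  apply: (@le_trans _ _ (\sum_(f : net_index N s) ((in_net f)%:R * (2 * q ^+ m))%:E)%E).
    exact: lee_sum.
  rewrite sumEFin lee_fin -mulr_suml -natr_sum -big_mkcond/= sum1_card.
  have Hq : (expR 1 * N%:R / s%:R) ^+ s * (16 * expR 1) ^+ s * (2 * q ^+ m) <= eps.
    by apply: union_bound_sample_size => //; apply/andP.
  apply: le_trans Hq; rewrite ler_wpM2r ?mulr_ge0 ?exprn_ge0 ?(ltW q0)//.
  exact: card_net.
apply: (@le_trans _ _ (P (~` Bad))).
  rewrite probability_setC// EFinB; exact: leeB.
apply: le_measure; rewrite ?inE//; first exact: measurableC.
(* A defect above [delta / 4] at a net point would make one of the two tilted sums nonnegative and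
   put [w] in [Bad]. *)
move=> w nBad; apply: ric_lt_of_net => // f fnet y1; rewrite leNgt; apply/negP => Hf.
apply: nBad; rewrite /Bad -bigcup_seq; exists f; first by rewrite /= mem_index_enum.
rewrite /bad fnet y1 /=; have [] := defect_gt_tilt l0 Hf; [by left|by right].
Qed.
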